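(* Let $\Omega$ be a bounded convex domain in $\mathbb{R}^n$, $u\in\mathbb{E}(\Omega)$ and $v\in\mathbb{E}(\Omega)\cap C^{0,1}(\overline\Omega)$. For $t\in\mathbb{R}$, let $\Gamma_{u+tv}$ be the convex envelope of $u+tv$ in $\overline\Omega$, that is, $$\Gamma_{u+tv}(x)=\sup\{\varphi(x):\varphi\le u+tv\text{ in }\overline\Omega,\ \varphi\text{ is convex in }\overline\Omega\}.$$ Then $$\frac{d}{dt}\Big|_{t=0}E(\Gamma_{u+tv})=(n+1)\int_\Omega(-v)\,d\mu_u.$$
   Context: For a convex function $u$ on $\Omega$, the subdifferential is $\partial u(x)=\{q\in\mathbb{R}^n: u(y)\ge u(x)+q\cdot(y-x)\ \forall y\in\Omega\}$, and the Monge--Ampère measure is $\mu_u(S)=|\partial u(S)|$ (Lebesgue measure) for Borel $S\subset\Omega$, where $\partial u(S)=\bigcup_{x\in S}\partial u(x)$. The finite energy class is $$\mathbb{E}(\Omega)=\Big\{w\in C(\overline\Omega): w\text{ convex in }\Omega,\ w=0\text{ on }\partial\Omega,\ \int_\Omega|w|\,d\mu_w<\infty\Big\},$$ and the Monge--Ampère energy is $E(u)=\int_\Omega(-u)\,d\mu_u$. *)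

(* Defs.v *)
From HB Require Import structures.
From mathcomp Require Import all_boot all_order all_algebra.
From mathcomp Require Import all_classical all_reals all_analysis.

Set Implicit Arguments.
Unset Strict Implicit.
Unset Printing Implicit Defensive.

Import Order.TTheory GRing.Theory Num.Theory.
Import numFieldNormedType.Exports.

Local Open Scope classical_set_scope.
Local Open Scope ring_scope.

(* R^n with its Borel sigma-algebra. *)
Definition borel_rV (R : realType) (n : nat) :=
  g_sigma_algebraType (@open 'rV[R]_n).

Section MongeAmpere.
Context {R : realType} {n : nat}.
Implicit Types (Omega S : set 'rV[R]_n) (u v w phi : 'rV[R]_n -> R).

Definition dotrV (p q : 'rV[R]_n) : R := \sum_(i < n) p ord0 i * q ord0 i.

Definition bounded_convex_domain Omega : Prop :=
  [/\ open Omega, Omega !=set0, convex_set Omega & bounded_set Omega].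

Definition boundary Omega : set 'rV[R]_n := closure Omega `\` interior Omega.

Definition closed_box (a b : 'rV[R]_n) : set 'rV[R]_n :=
  [set x | forall i : 'I_n, a ord0 i <= x ord0 i <= b ord0 i].

(* The Lebesgue measure of R^n, as the outer measure generated by the volumes
   of closed boxes. It is defined on all subsets, so that it can be applied to
   the images of Borel sets under a subdifferential, which are Lebesgue
   measurable but need not be Borel. For n = 0 a box is never empty, and the
   definition is meant for 0 < n only. *)
Definition lebesgue_rV (A : set 'rV[R]_n) : \bar R :=
  ereal_inf [set s | exists a b : nat -> 'rV[R]_n,
    [/\ forall k i, a k ord0 i <= b k ord0 i,
        A `<=` \bigcup_k closed_box (a k) (b k) &
        s = (\sum_(k <oo) (\prod_(i < n) (b k ord0 i - a k ord0 i))%:E)%E]].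

(* Functions on Omega or on its closure are represented by total functions;
   below, only their values on the relevant set matter. *)
Definition subdifferential Omega u (x : 'rV[R]_n) : set 'rV[R]_n :=
  [set q | forall y, Omega y -> u x + dotrV q (y - x) <= u y].

Definition monge_ampere Omega u (S : set (borel_rV R n)) : \bar R :=
  lebesgue_rV (\bigcup_(x in S `&` Omega) subdifferential Omega u x).

Definition ma_integral Omega u (f : 'rV[R]_n -> R) : \bar R :=
  (\int[monge_ampere Omega u]_(x in (Omega : set (borel_rV R n))) (f x)%:E)%E.

Definition finite_energy Omega w : Prop :=
  [/\ {within closure Omega, continuous w},
      convex_function Omega w,
      (forall x, boundary Omega x -> w x = 0) &
      (ma_integral Omega w (fun x => `|w x|)%R < +oo)%E].

Definition ma_energy Omega u : \bar R := ma_integral Omega u (fun x => - u x).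

Definition convex_envelope Omega (f : 'rV[R]_n -> R) (x : 'rV[R]_n) : R :=
  sup [set phi x | phi in [set phi : 'rV[R]_n -> R |
    (forall y, closure Omega y -> phi y <= f y) /\
    convex_function (closure Omega) phi]].

End MongeAmpere.

(* Main.v *)
(* For [w] on [K = closure Omega], let [w^*] be its Legendre transform over [K],
   [h = 0^*] the support function of [K], and [G w] the Lebesgue integral of
   [w^* - h].  For almost every [p] the maximum defining [u^* p] is attained at a
   single point [X p], and the Monge-Ampere measure of [u] is the image of the
   Lebesgue measure under [X].  By Danskin's formula the derivative of
   [t |-> (u + t v)^* p] at [0] is [- v (X p)]; since [t |-> (u + t v)^* p] is
   convex and nondecreasing, its difference quotients are dominated by
   [(u + v)^* - h], so the derivative of [G (u + t v)] at [0] is the integral of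
   [- v] against the Monge-Ampere measure of [u].  Applied to [v = u], where
   [G ((1 + t) u) = (1 + t) ^ (n + 1) * G u] because dilations scale the Lebesgue
   measure, this yields [E u = (n + 1) * G u].  A function and its convex envelope
   have the same Legendre transform, hence [E (Gamma t) = (n + 1) * G (u + t v)]
   and the theorem follows. *)
Require Import Defs.
From HB Require Import structures.
From mathcomp Require Import all_boot all_order all_algebra.
From mathcomp Require Import all_classical all_reals all_analysis.
From mathcomp Require Import measurable_realfun.
From mathcomp Require Import ring lra.

Set Implicit Arguments.
Unset Strict Implicit.
Unset Printing Implicit Defensive.

Import Order.TTheory GRing.Theory Num.Theory.
Import numFieldNormedType.Exports.

Local Open Scope classical_set_scope.
Local Open Scope ring_scope.

(** * Lebesgue outer measure generated by boxes *)

Definition volume {R : realType} {n} (a b : 'rV[R]_n) : R :=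
  \prod_(i < n) (b ord0 i - a ord0 i).

Lemma volume_ge0 {R : realType} {n} (a b : 'rV[R]_n) :
  (forall i, a ord0 i <= b ord0 i) -> 0 <= volume a b.
Proof. by move=> ab; apply: prodr_ge0 => i _; rewrite subr_ge0. Qed.

Section lebesgue_outer_measure.
Context {R : realType} {n : nat}.
Implicit Types (A X : set 'rV[R]_n.+1) (a b : 'rV[R]_n.+1).

Lemma lebesgue_rV_ge0 A : (0 <= lebesgue_rV A)%E.
Proof.
apply: le_ereal_inf_tmp => _ [a [b [ab _ ->]]].
by apply: nneseries_ge0 => k _ _; rewrite lee_fin; apply: volume_ge0.
Qed.

Lemma lebesgue_rV_cover A (a b : nat -> 'rV[R]_n.+1) :
  (forall k i, a k ord0 i <= b k ord0 i) ->
  A `<=` \bigcup_k closed_box (a k) (b k) ->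
  (lebesgue_rV A <= \sum_(k <oo) (volume (a k) (b k))%:E)%E.
Proof. by move=> ab Aab; apply: ereal_inf_lbound; exists a, b. Qed.

Lemma lebesgue_rV_box a b : (forall i, a ord0 i <= b ord0 i) ->
  (lebesgue_rV (closed_box a b) <= (volume a b)%:E)%E.
Proof.
(* Every box after the first is the single point [a], of volume zero because the dimension is
   positive. *)
move=> ab; pose b' k := if k is 0%N then b else a.
apply: (le_trans (@lebesgue_rV_cover _ (fun=> a) b' _ _)).
- by case=> [|k] i /=.
- by move=> x xab; exists 0%N.
rewrite nneseries_recl//; last first.
  by move=> k _; rewrite lee_fin; apply: volume_ge0 => i; case: k => [|k] /=.
rewrite eseries_cond eseries0 ?adde0// => -[//|k] _ _ /=.
by rewrite /volume big_ord_recl subrr mul0r.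
Qed.

Lemma lebesgue_rV0 : lebesgue_rV (set0 : set 'rV[R]_n.+1) = 0%E.
Proof.
apply/eqP; rewrite eq_le lebesgue_rV_ge0 andbT.
apply: (le_trans (@lebesgue_rV_cover _ (fun=> 0) (fun=> 0) _ _)) => //.
by rewrite eseries0// => k _ _; rewrite /volume big_ord_recl subrr mul0r.
Qed.

(** When all [F k] have finite measure, each is covered up to an error [e / 2 ^ k.+1], and a
    bijection between [nat] and [nat * nat] arranges these covers in one sequence. *)
Lemma lebesgue_rV_sigma_subadditive A (F : nat -> set 'rV[R]_n.+1) :
  subset_sigma_subadditive lebesgue_rV A F.
Proof.
move=> AF; have [[i ioo]|] := pselect (exists i, lebesgue_rV (F i) = +oo%E).
  by rewrite (eseries_pinfty _ _ ioo) ?leey// => k _;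
    rewrite -ltNye (lt_le_trans _ (lebesgue_rV_ge0 _)).
rewrite -forallNE => Foo; apply/lee_addgt0Pr => e e0.
apply: le_trans (epsilon_trick _ (fun k => lebesgue_rV_ge0 (F k)) (ltW e0)).
pose P k (G : (nat -> 'rV[R]_n.+1) * (nat -> 'rV[R]_n.+1)) :=
  [/\ forall j i, G.1 j ord0 i <= G.2 j ord0 i,
      F k `<=` \bigcup_j closed_box (G.1 j) (G.2 j) &
      (\sum_(j <oo) (volume (G.1 j) (G.2 j))%:E <=
       lebesgue_rV (F k) + (e / (2 ^ k.+1)%:R)%:E)%E].
have [G PG] : {G & forall k, P k (G k)}.
  apply: (@choice _ _ P) => k.
  have fink : lebesgue_rV (F k) \is a fin_num.
    by rewrite ge0_fin_numE ?lebesgue_rV_ge0// ltey; apply/eqP.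
  have ek0 : 0 < e / (2 ^ k.+1)%:R by rewrite divr_gt0// ltr0n expn_gt0.
  have [_ [a [b [ab Fab ->]]] /ltW abk] := lb_ereal_inf_adherent ek0 fink.
  by exists (a, b).
have /card_esym/ppcard_eqP[f] := card_nat2.
pose g x := (volume ((G x.1).1 x.2) ((G x.1).2 x.2))%:E : \bar R.
have g0 x : (0 <= g x)%E.
  by rewrite lee_fin volume_ge0//; have [ab _ _] := PG x.1; exact: ab.
apply: (@le_trans _ _ (\sum_(k <oo) g (f k))%E).
  apply: (@lebesgue_rV_cover _ (fun k => (G (f k).1).1 (f k).2)
    (fun k => (G (f k).1).2 (f k).2)).
    by move=> k i; have [ab _ _] := PG (f k).1; exact: ab.
  move=> x /AF[k _ Fkx]; have [_ /(_ _ Fkx)[j _ xj] _] := PG k.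
  by exists (f^-1%FUN (k, j)) => //=; rewrite invK ?inE.
rewrite nneseries_esumT; last by move=> k; exact: g0.
rewrite -(reindex_esum setT setT f g)//.
rewrite [X in (X <= _)%E](_ : _ = \esum_(i in setT) \esum_(j in setT) g (i, j))%E;
  last first.
  rewrite (@esum_esum _ _ _ setT (fun=> setT) (fun i j => g (i, j)))//.
  rewrite (_ : setT `*`` _ = setT); last by apply/seteqP; split=> -[].
  by apply: eq_esum => -[].
rewrite -nneseries_esumT; last by move=> i; apply: esum_ge0.
apply: lee_nneseries => [k _ _|k _]; first exact: esum_ge0.
by rewrite -nneseries_esumT//; have [] := PG k.
Qed.

HB.instance Definition _ := isSubsetOuterMeasure.Build R 'rV[R]_n.+1
  (@lebesgue_rV R n.+1) lebesgue_rV0 lebesgue_rV_ge0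
  lebesgue_rV_sigma_subadditive.

End lebesgue_outer_measure.

(** * Borel measurability of maps into and out of R^n *)

Section borel_maps.
Context {R : realType} {n : nat}.

Lemma ball_rV (x y : 'rV[R]_n) (e : R) : 0 < e ->
  ball x e y <-> forall i, `|x ord0 i - y ord0 i| < e.
Proof.
move=> e0; split=> [[_ xy] i|xy]; first exact: xy.
by split=> // i j; rewrite (ord1 i); exact: xy.
Qed.

(** [U] is the countable union of the balls inside it with rational center and radius [1 / (m + 1)].
    Balls of the sup norm are finite intersections of conditions on single coordinates. *)
Lemma measurable_rV_open d (T : measurableType d) (X : T -> 'rV[R]_n) :
  (forall i, measurable_fun setT (fun t => X t ord0 i)) ->
  forall U, open U -> measurable (X @^-1` U).
Proof.
move=> mX U oU.
pose q2r (q : 'rV[rat]_n) : 'rV[R]_n := \row_i ratr (q ord0 i).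
pose B (p : 'rV[rat]_n * nat) := ball (q2r p.1) (p.2.+1%:R^-1 : R).
pose F p := if `[< B p `<=` U >] then X @^-1` B p else set0.
have -> : X @^-1` U = \bigcup_p F p.
  apply/seteqP; split=> [t Ut|t [p _]]; last first.
    by rewrite /F; case: ifPn => // /asboolP BU /BU.
  have /nbhs_ballP[e /= e0 eU] : nbhs (X t) U by exact: open_nbhs_nbhs.
  (* With a radius below [e / 2], a ball around a rational point that contains [X t] stays inside
     the ball of radius [e] around [X t]. *)
  have [m me] : exists m, m.+1%:R^-1 < e / 2.
    have := @ltr_add_invr _ 0 (e/2); rewrite divr_gt0// => /(_ isT)[m].
    by rewrite add0r; exists m.
  have /choice[q qX] : forall i, exists q : rat,
      `|ratr q - X t ord0 i| < m.+1%:R^-1.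
    move=> i; have [|q] := @rat_in_itvoo R (X t ord0 i - m.+1%:R^-1)
        (X t ord0 i + m.+1%:R^-1).
      by rewrite ltrBlDr -addrA ltrDl addr_gt0// invr_gt0.
    by rewrite in_itv/= => qX; exists q; rewrite ltr_distl.
  exists (\row_i q i, m) => //; rewrite /F ifT /B/=; last first.
    apply/asboolP => y qy; apply: eU.
    have qX' : ball (X t) (m.+1%:R^-1) (q2r (\row_i q i)).
      apply/ball_rV => [|i]; first by rewrite invr_gt0.
      by rewrite !mxE distrC.
    apply: (le_ball _ (ball_triangle qX' qy)).
    by rewrite (splitr e) lerD// ltW.
  by apply/ball_rV => [|i]; rewrite ?invr_gt0// !mxE.
apply: countable_bigcupT_measurable; first exact: countableP.
move=> p; rewrite /F; case: ifPn => // _.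
have -> : X @^-1` B p = \bigcap_(i in [set: 'I_n])
    ((fun t => X t ord0 i) @^-1` ball (q2r p.1 ord0 i) (p.2.+1%:R^-1 : R)).
  apply/seteqP; split=> t.
    by move=> /ball_rV h i _; apply: h; rewrite invr_gt0.
  by move=> h; apply/ball_rV => [|i]; rewrite ?invr_gt0//; exact: h.
apply: fin_bigcap_measurable => // i _.
rewrite -[X in measurable X]setTI; apply: mX => //.
by apply: open_measurable; apply: ball_open; rewrite invr_gt0.
Qed.

Lemma measurable_rV d (T : measurableType d) (X : T -> borel_rV R n) :
  (forall i, measurable_fun setT (fun t => (X t : 'rV[R]_n) ord0 i)) ->
  measurable_fun setT X.
Proof.
move=> mX; apply: (measurability (@open 'rV[R]_n : set (set (borel_rV R n)))) => //.
by move=> _ [U oU <-]; rewrite setTI; exact: measurable_rV_open.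
Qed.

Lemma open_borel_rV (U : set 'rV[R]_n) : open U ->
  measurable (U : set (borel_rV R n)).
Proof. by move=> oU; exact: sub_sigma_algebra. Qed.

Lemma continuous_borel_rV (f : 'rV[R]_n -> R) : continuous f ->
  measurable_fun setT (f : borel_rV R n -> R).
Proof.
move=> cf; apply: (measurability _ (RGenOpens.measurableE R)) => //.
move=> _ [_ [a [b ->] <-]]; rewrite setTI; apply: open_borel_rV.
by apply: open_comp => //; exact: interval_open.
Qed.

Lemma within_continuous_borel_rV (f : 'rV[R]_n -> R) (D : set 'rV[R]_n) :
  open D -> {in D, continuous f} ->
  measurable_fun (D : set (borel_rV R n)) (f : borel_rV R n -> R).
Proof.
move=> oD cf; apply: (measurability _ (RGenOpens.measurableE R)) => //.
move=> _ [_ [a [b ->] <-]]; apply: open_borel_rV.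
rewrite openE => x [Dx fx]; apply: filterI; first exact: open_nbhs_nbhs.
apply: (cf x); first by rewrite inE.
by apply: open_nbhs_nbhs; split=> //; exact: interval_open.
Qed.

End borel_maps.

(** * Lebesgue measure on Borel sets *)

Section lebesgue_borel.
Context {R : realType} {n : nat}.
Notation V := 'rV[R]_n.+1.
Implicit Types (A X : set V) (a b : V).

Definition set_coord a (i : 'I_n.+1) (c : R) : V :=
  \row_j (if j == i then c else a ord0 j).

Lemma volume_split a b i c :
  volume (set_coord a i c) b + volume a (set_coord b i c) = volume a b.
Proof.
have e (x y : V) : volume x y = (y ord0 i - x ord0 i) *
    \prod_(j < n.+1 | j != i) (y ord0 j - x ord0 j).
  by rewrite /volume (bigD1 i).
rewrite !e !mxE eqxx.
rewrite (eq_bigr (fun j => b ord0 j - a ord0 j)) => [|j /negbTE ji]; last first.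
  by rewrite mxE ji.
rewrite [X in _ + _ * X](eq_bigr (fun j => b ord0 j - a ord0 j)) => [|j /negbTE ji].
  by rewrite -mulrDl addrA subrK.
by rewrite mxE ji.
Qed.

(** The hyperplane [x_i = c] cuts each box of a cover into two boxes, whose volumes add up by
    [volume_split]. *)
Lemma caratheodory_halfspace i (c : R) :
  (@lebesgue_rV R n.+1).-caratheodory [set x | x ord0 i <= c].
Proof.
apply: le_caratheodory_measurable => X.
apply: le_ereal_inf_tmp => _ [a [b [ab Xab ->]]].
(* This is [c] clamped to the [i]-th side of the box: a box that misses the hyperplane gets a
   degenerate half rather than one with reversed ends. *)
pose m k := Num.max (a k ord0 i) (Num.min (b k ord0 i) c).
have am k : a k ord0 i <= m k by rewrite le_max lexx.
have mb k : m k <= b k ord0 i by rewrite ge_max ab ge_min lexx.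
have le1 k j : set_coord (a k) i (m k) ord0 j <= b k ord0 j.
  by rewrite mxE; case: eqP => [->|].
have le2 k j : a k ord0 j <= set_coord (b k) i (m k) ord0 j.
  by rewrite mxE; case: eqP => [->|].
apply: (@le_trans _ _ (\sum_(k <oo) ((volume (a k) (set_coord (b k) i (m k)))%:E +
    (volume (set_coord (a k) i (m k)) (b k))%:E))%E); last first.
  by rewrite (eq_eseriesr (g := fun k => (volume (a k) (b k))%:E))// => k _;
    rewrite -EFinD addrC volume_split.
rewrite nneseriesD; [|by move=> k _ _; rewrite lee_fin volume_ge0..].
apply: leeD; apply: lebesgue_rV_cover => //.
- move=> x [Xx /= xc]; have [k _ xk] := Xab _ Xx; exists k => // j.
  rewrite mxE; case: eqP => [->|_]; last exact: xk.
  by have /andP[-> xb] := xk i; rewrite /= /m le_max le_min xb xc orbT.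
- move=> x [Xx /= /negP]; rewrite -ltNge => xc.
  have [k _ xk] := Xab _ Xx; exists k => // j.
  rewrite mxE; case: eqP => [->|_]; last exact: xk.
  by have /andP[xa ->] := xk i; rewrite /m ge_max xa ge_min (ltW xc) orbT.
Qed.

(** Half-spaces make the coordinates measurable on the Caratheodory sets, so the identity map into
    the Borel sets is measurable. *)
Lemma caratheodory_borel A : measurable (A : set (borel_rV R n.+1)) ->
  (@lebesgue_rV R n.+1).-caratheodory A.
Proof.
pose T := caratheodory_type (@lebesgue_rV R n.+1).
have mid : measurable_fun setT (id : T -> borel_rV R n.+1).
  apply: measurable_rV => i.
  apply: (measurability _ (RGenOInfty.measurableE R)) => //.
  move=> _ [_ [c ->] <-]; rewrite setTI.
  have -> : (fun t : T => (t : V) ord0 i) @^-1` `]c, +oo[%classic =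
      ~` [set x : V | x ord0 i <= c].
    by apply/seteqP; split=> x /=; rewrite in_itv/= andbT ltNge => /negP.
  by apply: (@measurableC _ T); exact: caratheodory_halfspace.
by move=> mA; have := mid measurableT _ mA; rewrite setTI.
Qed.

Let lebesgue_rV_semi_sigma_additive :
  semi_sigma_additive (@lebesgue_rV R n.+1 : set (borel_rV R n.+1) -> \bar R).
Proof.
move=> F mF tF mUF.
apply: (@caratheodory_measure_sigma_additive _ _ (@lebesgue_rV R n.+1)) => //.
  by move=> k; exact: caratheodory_borel.
exact: caratheodory_borel.
Qed.

(* [lebesgue_rV] under a new name, to carry the measure structure on the Borel
   sets next to the outer measure structure on all sets. *)
Definition lebesgue_borel : set (borel_rV R n.+1) -> \bar R := @lebesgue_rV R n.+1.

HB.instance Definition _ := isMeasure.Build _ (borel_rV R n.+1) R lebesgue_borel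
  lebesgue_rV0 lebesgue_rV_ge0 lebesgue_rV_semi_sigma_additive.

(** The image of a cover by boxes is again a cover by boxes, with volumes multiplied by [c ^ n.+1].
    The opposite inequality will come from the inverse map. *)
Lemma lebesgue_rV_affine_le (c : R) (q : V) A : 0 < c ->
  (lebesgue_rV [set (c *: x + q)%R | x in A] <= (c ^+ n.+1)%:E * lebesgue_rV A)%E.
Proof.
move=> c0; have cn0 : 0 < c ^+ n.+1 by rewrite exprn_gt0.
rewrite muleC -lee_pdivrMr//.
apply: le_ereal_inf_tmp => _ [a [b [ab Aab ->]]].
rewrite lee_pdivrMr// muleC -nneseriesZl//; last first.
  by move=> k _; rewrite lee_fin; apply: volume_ge0.
rewrite (_ : (\sum_(k <oo) _)%E = (\sum_(k <oo)
   (volume (c *: a k + q) (c *: b k + q))%:E)%E).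
  apply: lebesgue_rV_cover.
    by move=> k i; rewrite !mxE lerD2r ler_pM2l.
  move=> _ [x /Aab[k _ xk] <-]; exists k => // i.
  by rewrite !mxE !lerD2r !ler_pM2l.
apply: eq_eseriesr => k _; rewrite -EFinM; congr EFin.
rewrite /volume -{1}[n.+1]card_ord -prodr_const -big_split/=.
by apply: eq_bigr => i _; rewrite !mxE; ring.
Qed.

End lebesgue_borel.

(** * Translations and dilations in Lebesgue integrals *)

Section affine_change_of_variables.
Context {R : realType} {n : nat}.
Notation V := 'rV[R]_n.+1.
Notation lambda := (@lebesgue_borel R n).

Lemma lebesgue_borel_affine_preimage (c : R) (q : V) (A : set V) : 0 < c ->
  lambda [set p | A (c *: p + q)] = (((c ^+ n.+1)^-1)%:E * lambda A)%E.
Proof.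
move=> c0; have ci0 : 0 < c^-1 by rewrite invr_gt0.
have cn0 : 0 < c ^+ n.+1 by rewrite exprn_gt0.
have E1 : [set p | A (c *: p + q)] = [set c^-1 *: x + (- (c^-1 *: q)) | x in A].
  apply/seteqP; split=> [p Ap|_ [x Ax <-]] /=.
    exists (c *: p + q) => //.
    by rewrite scalerDr scalerA mulVf ?gt_eqF// scale1r addrK.
  by rewrite scalerBr !scalerA divff ?gt_eqF// !scale1r subrK.
apply/eqP; rewrite eq_le; apply/andP; split.
  by rewrite E1 -exprVn; exact: lebesgue_rV_affine_le.
rewrite lee_pdivrMl//.
have := @lebesgue_rV_affine_le R n c q [set p | A (c *: p + q)] c0.
apply: le_trans; apply: le_outer_measure => x Ax.
exists (c^-1 *: (x - q)) => /=;
  by rewrite scalerA divff ?gt_eqF// scale1r subrK.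
Qed.

Lemma affine_measurable (c : R) (q : V) :
  measurable_fun setT ((fun p : V => c *: p + q) : borel_rV R n.+1 -> borel_rV R n.+1).
Proof.
apply: measurable_rV => i.
have -> : (fun p : V => (c *: p + q) ord0 i) = (fun p => c * p ord0 i + q ord0 i).
  by apply/funext => p; rewrite !mxE.
apply: measurable_funD; last exact: measurable_cst.
apply: measurable_funM; first exact: measurable_cst.
by apply: continuous_borel_rV; exact: coord_continuous.
Qed.

(** The image of [lambda] under the affine map is a multiple of [lambda]. The case [c = 1] is
    translation invariance, and [q = 0] handles dilations. *)
Lemma ge0_integral_affine (f : borel_rV R n.+1 -> \bar R) (c : R) (q : V) : 0 < c ->
  measurable_fun setT f -> (forall p, 0 <= f p)%E ->
  (\int[lambda]_p f (c *: (p : V) + q)%R = ((c ^+ n.+1)^-1)%:E * \int[lambda]_p f p)%E.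
Proof.
move=> c0 mf f0.
pose phi := (fun p : V => c *: p + q) : borel_rV R n.+1 -> borel_rV R n.+1.
have k0 : 0 <= (c ^+ n.+1)^-1 by rewrite invr_ge0 exprn_ge0// ltW.
have -> : (\int[lambda]_p f (c *: (p : V) + q)%R =
    \int[pushforward lambda phi]_p f p)%E.
  by rewrite ge0_integral_pushforward//; exact: affine_measurable.
rewrite -[X in (X%:E * _)%E]/((NngNum k0)%:num) -ge0_integral_mscale//.
apply: eq_measure_integral => [|? A mA _]; first exact: affine_measurable.
exact: lebesgue_borel_affine_preimage.
Qed.

Lemma lebesgue_borel_closed_box (a b : V) : (lambda (closed_box a b) < +oo)%E.
Proof.
pose b' : V := \row_i Num.max (a ord0 i) (b ord0 i).
apply: (@le_lt_trans _ _ (volume a b')%:E); last by rewrite ltry.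
apply: le_trans (@lebesgue_rV_box R n a b' _).
  by apply: le_outer_measure => x abx i; rewrite mxE le_max;
    have /andP[-> ->] := abx i; rewrite orbT.
by move=> i; rewrite mxE le_max lexx.
Qed.

Lemma measurable_closed_box (a b : V) :
  measurable (closed_box a b : set (borel_rV R n.+1)).
Proof.
rewrite (_ : closed_box a b = \bigcap_(i in [set: 'I_n.+1])
  ((fun x : V => x ord0 i) @^-1` `[a ord0 i, b ord0 i]%classic)).
  apply: fin_bigcap_measurable => // i _.
  rewrite -[X in measurable X]setTI; apply: continuous_borel_rV => //.
  exact: coord_continuous.
by apply/seteqP; split=> x h i; have := h i; rewrite /= in_itv/= => // /(_ I).
Qed.

End affine_change_of_variables.

(** * Dot product and Lipschitz maps *)

Section dot_product.
Context {R : realType} {n : nat}.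
Implicit Types (p q x y : 'rV[R]_n) (c : R).

Lemma dotrVDl p q x : dotrV (p + q) x = dotrV p x + dotrV q x.
Proof.
by rewrite /dotrV -big_split; apply: eq_bigr => i _; rewrite mxE mulrDl.
Qed.

Lemma dotrVZl c p x : dotrV (c *: p) x = c * dotrV p x.
Proof. by rewrite /dotrV mulr_sumr; apply: eq_bigr => i _; rewrite mxE mulrA. Qed.

Lemma dotrVDr p x y : dotrV p (x + y) = dotrV p x + dotrV p y.
Proof.
by rewrite /dotrV -big_split; apply: eq_bigr => i _; rewrite mxE mulrDr.
Qed.

Lemma dotrVZr c p x : dotrV p (c *: x) = c * dotrV p x.
Proof.
by rewrite /dotrV mulr_sumr; apply: eq_bigr => i _; rewrite mxE mulrCA.
Qed.

Lemma dotrVBr p x y : dotrV p (x - y) = dotrV p x - dotrV p y.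
Proof. by rewrite dotrVDr -scaleN1r dotrVZr mulN1r. Qed.

Lemma dotrVBl p q x : dotrV (p - q) x = dotrV p x - dotrV q x.
Proof. by rewrite dotrVDl -scaleN1r dotrVZl mulN1r. Qed.

Lemma dotrV_delta i x : dotrV (delta_mx ord0 i) x = x ord0 i.
Proof.
rewrite /dotrV (bigD1 i)//= mxE !eqxx mul1r big1 ?addr0// => j /negbTE ji.
by rewrite mxE eqxx ji mul0r.
Qed.

Lemma ler_coord_norm x i : `|x ord0 i| <= `|x|.
Proof.
rewrite [leRHS]/Num.norm /= mx_normrE; apply/bigmax_geP; right => /=.
by exists (ord0, i).
Qed.

Lemma ler_norm_dotrV p x : `|dotrV p x| <= (\sum_i `|p ord0 i|) * `|x|.
Proof.
rewrite mulr_suml; apply: le_trans (ler_norm_sum _ _ _) _.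
by apply: ler_sum => i _; rewrite normrM ler_wpM2l// ler_coord_norm.
Qed.

Lemma dotrVC p x : dotrV p x = dotrV x p.
Proof. by apply: eq_bigr => i _; rewrite mulrC. Qed.

Lemma lipschitz_continuous (f : 'rV[R]_n -> R) (M : R) :
  (forall x y, `|f x - f y| <= M * `|x - y|) -> continuous f.
Proof.
move=> fM x A /nbhs_normP[e /= e0 eA].
(* [M] may vanish, whereas this larger constant can be divided by. *)
have M1 : 0 < `|M| + 1 by rewrite ltr_wpDl.
apply: (@nbhs_normP R _ x (f @^-1` A)).2; exists ((`|M| + 1)^-1 * e) => [|y xy].
  by rewrite /= mulr_gt0// invr_gt0.
apply: eA => /=; apply: (le_lt_trans (fM _ _)).
apply: (@le_lt_trans _ _ ((`|M| + 1) * `|x - y|)).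
  by rewrite ler_wpM2r// (le_trans (ler_norm _))// lerDl.
by rewrite -ltr_pdivlMl.
Qed.

Lemma continuous_dotrV p : continuous (dotrV p).
Proof.
apply: (@lipschitz_continuous _ (\sum_i `|p ord0 i|)) => x y.
by rewrite -dotrVBr; exact: ler_norm_dotrV.
Qed.

End dot_product.

(** * Legendre transform and its one-sided partial derivatives *)

Section legendre.
Context {R : realType} {n : nat} (K : set 'rV[R]_n).
Implicit Types (w : 'rV[R]_n -> R) (p q x : 'rV[R]_n).

Definition argmax w p x :=
  K x /\ forall y, K y -> dotrV p y - w y <= dotrV p x - w x.

(** Attainment turns the [sup] in [legendre] into a maximum, so that it never takes its default
    value. *)
Definition attained w := forall p, exists x, argmax w p x.

Definition legendre w p := sup [set dotrV p x - w x | x in K].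

Lemma legendre_argmax w p x : argmax w p x -> legendre w p = dotrV p x - w x.
Proof.
move=> [Kx xmax]; apply/eqP; rewrite eq_le; apply/andP; split.
  apply: ge_sup; first by exists (dotrV p x - w x), x.
  by move=> _ [y Ky <-]; exact: xmax.
apply: ub_le_sup; last by exists x.
by exists (dotrV p x - w x) => _ [y Ky <-]; exact: xmax.
Qed.

Lemma le_legendre w p x : attained w -> K x -> dotrV p x - w x <= legendre w p.
Proof. by move=> /(_ p)[y ymax] Kx; rewrite (legendre_argmax ymax); apply: ymax.2. Qed.

Lemma attained_continuous w : compact K -> K !=set0 -> {within K, continuous w} ->
  attained w.
Proof.
move=> cK [x0 Kx0] cw p.
have cf : {within K, continuous (fun x => dotrV p x - w x)}.
  move=> x; apply: cvgB; last exact: cw.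
  by apply: continuous_subspaceT => y; exact: continuous_dotrV.
have [|x xK xmax] := @EVT_max_rV _ _ _ K _ cK cf; first by exists x0.
exists x; split=> [|y Ky]; first by move: xK; rewrite inE.
by apply: xmax; rewrite inE.
Qed.

Variables (w : 'rV[R]_n -> R) (L : R).
Hypotheses (aw : attained w) (KL : forall x i, K x -> `|x ord0 i| <= L).
Notation H := (legendre w).

(** Testing the supremum at [q] with [x] shows that a maximizer at [p] is a subgradient of the
    transform at [p]. *)
Lemma legendre_le_argmax p q x : argmax w p x -> H p - H q <= dotrV (p - q) x.
Proof.
move=> px; have [y qy] := aw q.
rewrite (legendre_argmax px) (legendre_argmax qy) dotrVBl.
by have := qy.2 x px.1; lra.
Qed.

(** Maximizers lie in [K], so these subgradients have coordinates bounded by [L] and the transform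
    is Lipschitz. *)
Lemma continuous_legendre_shift q0 : continuous (fun p => H (p + q0)).
Proof.
have HL p q : H p - H q <= (\sum_(i < n) L) * `|p - q|.
  have [x px] := aw p.
  apply: (le_trans (legendre_le_argmax q px)).
  rewrite (le_trans (ler_norm _))// dotrVC (le_trans (ler_norm_dotrV _ _))//.
  by rewrite ler_wpM2r//; apply: ler_sum => i _; apply: KL; exact: px.1.
apply: (@lipschitz_continuous _ _ _ (\sum_(i < n) L)) => p q.
have -> : p - q = (p + q0) - (q + q0) by rewrite opprD addrACA subrr addr0.
by rewrite ler_norml HL andbT lerNl opprB distrC HL.
Qed.

Lemma continuous_legendre : continuous H.
Proof.
rewrite (_ : legendre w = fun p => legendre w (p + 0)).
  exact: continuous_legendre_shift.
by apply/funext => p; rewrite addr0.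
Qed.

Section partial_derivatives.
Variable i : 'I_n.
Notation e := (delta_mx ord0 i).

(** This combines the subgradient inequalities at the two ends of the segment. *)
Lemma legendre_slope p t x y : 0 < t -> argmax w p x -> argmax w (p + t *: e) y ->
  x ord0 i <= (H (p + t *: e) - H p) / t <= y ord0 i.
Proof.
move=> t0 px py; rewrite ler_pdivlMr// ler_pdivrMr//.
have := legendre_le_argmax (p + t *: e) px; have := legendre_le_argmax p py.
rewrite addrAC subrr add0r opprD addrA subrr add0r -scaleNr !dotrVZl !dotrV_delta.
by move=> ? ?; apply/andP; split; lra.
Qed.

(** Only the steps [1 / (k + 1)] are used: a countable family keeps the infimum and the supremum
    below measurable, and by convexity of the transform these are its one-sided partial
    derivatives. *)
Definition right_slope p (k : nat) := (H (p + k.+1%:R^-1 *: e) - H p) / k.+1%:R^-1.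
Definition left_slope p (k : nat) := (H p - H (p - k.+1%:R^-1 *: e)) / k.+1%:R^-1.
Definition right_derivative p := infs (right_slope p) 0.
Definition left_derivative p := sups (left_slope p) 0.

Lemma right_slopeP p k x y : argmax w p x -> argmax w (p + k.+1%:R^-1 *: e) y ->
  x ord0 i <= right_slope p k <= y ord0 i.
Proof. by move=> px py; apply: legendre_slope. Qed.

Lemma left_slopeP p k x y : argmax w (p - k.+1%:R^-1 *: e) x -> argmax w p y ->
  x ord0 i <= left_slope p k <= y ord0 i.
Proof.
move=> px py; have := @legendre_slope (p - k.+1%:R^-1 *: e) k.+1%:R^-1 x y.
by rewrite subrK; apply.
Qed.

Lemma right_slope_lb p : has_lbound (range (right_slope p)).
Proof.
have [x px] := aw p; exists (x ord0 i) => _ [k _ <-].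
have [y py] := aw (p + k.+1%:R^-1 *: e).
by have /andP[] := right_slopeP px py.
Qed.

Lemma left_slope_ub p : has_ubound (range (left_slope p)).
Proof.
have [x px] := aw p; exists (x ord0 i) => _ [k _ <-].
have [y py] := aw (p - k.+1%:R^-1 *: e).
by have /andP[] := left_slopeP py px.
Qed.

Lemma sdrop0 (u : R^nat) : sdrop u 0 = range u.
Proof. by rewrite /sdrop; congr (_ @` _); apply/seteqP; split. Qed.

Lemma right_derivative_le p k : right_derivative p <= right_slope p k.
Proof.
by apply: ge_inf; [rewrite sdrop0; exact: right_slope_lb|exists k].
Qed.

Lemma left_derivative_ge p k : left_slope p k <= left_derivative p.
Proof.
by apply: ub_le_sup; [rewrite sdrop0; exact: left_slope_ub|exists k].
Qed.

(** A subgradient lies between all left and all right slopes. Where the one-sided derivatives agree,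
    they determine the coordinate of every maximizer. *)
Lemma argmax_derivative p x : argmax w p x ->
  left_derivative p <= x ord0 i <= right_derivative p.
Proof.
move=> px; apply/andP; split.
  apply: ge_sup; first by exists (left_slope p 0), 0%N.
  move=> _ [k _ <-]; have [y py] := aw (p - k.+1%:R^-1 *: e).
  by have /andP[] := left_slopeP py px.
apply: lb_le_inf; first by exists (right_slope p 0), 0%N.
move=> _ [k _ <-]; have [y py] := aw (p + k.+1%:R^-1 *: e).
by have /andP[] := right_slopeP px py.
Qed.

Lemma left_le_right p : left_derivative p <= right_derivative p.
Proof.
by have [x /argmax_derivative/andP[+ +]] := aw p; exact: le_trans.
Qed.

Lemma right_derivative_le_bound p : right_derivative p <= L.
Proof.
apply: le_trans (right_derivative_le p 0) _.
have [x px] := aw p; have [y py] := aw (p + 1%:R^-1 *: e).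
have /andP[_ /le_trans] := right_slopeP px py; apply.
by apply: le_trans (ler_norm _) _; apply: KL; exact: py.1.
Qed.

Lemma right_derivative_ge_bound p : - L <= right_derivative p.
Proof.
have [x px] := aw p; have /andP[_] := argmax_derivative px; apply: le_trans.
by have := KL i px.1; rewrite ler_norml => /andP[].
Qed.

(** Slopes of a convex function over successive disjoint intervals increase; the maximizers at the
    endpoints of the intervals form the chain of inequalities. *)
Lemma right_le_left p s : 0 < s -> right_derivative (p - s *: e) <= left_derivative p.
Proof.
move=> s0.
(* A step [h < s / 2] keeps the segment of length [h] starting at [p - s e] apart from the one
   ending at [p]. *)
have s20 : 0 < s / 2 by rewrite divr_gt0.
have [k] := ltr_add_invr s20; rewrite add0r => ks.
set h := k.+1%:R^-1 in ks.
have h0 : 0 < h by rewrite invr_gt0.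
apply: le_trans (right_derivative_le _ k) _.
apply: le_trans (left_derivative_ge _ k).
have [x px] := aw (p - s *: e); have [y py] := aw (p - s *: e + h *: e).
have [x' px'] := aw (p - h *: e); have [y' py'] := aw p.
have /andP[_ /le_trans] := right_slopeP px py; apply.
have /andP[+ _] := left_slopeP px' py'; apply: le_trans.
have t0 : 0 < s - h - h by lra.
have E : p - h *: e = p - s *: e + h *: e + (s - h - h) *: e.
  by apply/rowP => j; rewrite !mxE; ring.
rewrite E in px'.
by have /andP[/le_trans] := legendre_slope t0 py px'; apply.
Qed.

Lemma measurable_right_derivative :
  measurable_fun setT (right_derivative : borel_rV R n -> R).
Proof.
apply: (@measurable_fun_infs _ (borel_rV R n) R setT
  (fun k => right_slope^~ k) 0) => [p _|k].
  exact: right_slope_lb.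
apply: measurable_funM; last exact: measurable_cst.
apply: measurable_funB; apply: continuous_borel_rV.
  exact: continuous_legendre_shift.
exact: continuous_legendre.
Qed.

Lemma measurable_left_derivative :
  measurable_fun setT (left_derivative : borel_rV R n -> R).
Proof.
apply: (@measurable_fun_sups _ (borel_rV R n) R setT
  (fun k => left_slope^~ k) 0) => [p _|k].
  exact: left_slope_ub.
apply: measurable_funM; last exact: measurable_cst.
apply: measurable_funB; apply: continuous_borel_rV.
  exact: continuous_legendre.
exact: continuous_legendre_shift.
Qed.

(* The jumps telescope because the right derivative at [q - (j + 1) / N] is
   below the left derivative at [q - j / N]. *)
Lemma sum_jump_le (N : nat) q : \sum_(j < N.+1)
  (right_derivative (q - (j%:R / N.+1%:R) *: e) -
   left_derivative (q - (j%:R / N.+1%:R) *: e)) <= L *+ 2.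
Proof.
pose F j := - right_derivative (q - (j%:R / N.+1%:R) *: e).
apply: (@le_trans _ _ (\sum_(0 <= j < N.+1) (F j.+1 - F j))).
  rewrite big_mkord; apply: ler_sum => j _.
  rewrite opprK addrC lerD2r lerN2.
  have N0 : 0 < N.+1%:R^-1 :> R by rewrite invr_gt0.
  have := right_le_left (q - (j%:R / N.+1%:R) *: e) N0.
  apply: le_trans; rewrite le_eqVlt; apply/orP; left; apply/eqP.
  congr right_derivative; rewrite -addrA -opprD -scalerDl; congr (_ - _ *: _).
  by rewrite -[X in _ + X]mul1r -mulrDl natr1.
rewrite telescope_sumr// mulr2n; apply: lerD.
  by rewrite lerNl; exact: right_derivative_ge_bound.
by rewrite (opprK (right_derivative _)); exact: right_derivative_le_bound.
Qed.

End partial_derivatives.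

End legendre.

(** * Almost everywhere uniqueness of the maximizer *)

Section gradient.
Context {R : realType} {n : nat} (K : set 'rV[R]_n.+1).
Notation V := 'rV[R]_n.+1.
Notation lambda := (@lebesgue_borel R n).
Variables (w : V -> R) (L : R).
Hypotheses (aw : attained K w) (KL : forall x i, K x -> `|x ord0 i| <= L).

(** Right derivatives are defined and measurable everywhere, which makes this a total measurable
    choice of the almost everywhere unique maximizer. *)
Definition gradient (p : V) : V := \row_i right_derivative K w i p.

Lemma measurable_gradient :
  measurable_fun setT (gradient : borel_rV R n.+1 -> borel_rV R n.+1).
Proof.
apply: measurable_rV => i.
rewrite (_ : (fun _ => _) = right_derivative K w i); last first.
  by apply/funext => p; rewrite mxE.
exact: (measurable_right_derivative aw KL).
Qed.

Let box (m : nat) : set V := closed_box (const_mx (- m%:R)) (const_mx m%:R).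

Let box_shift m (p : V) i (s : R) : 0 <= s <= 1 ->
  box m (p - s *: delta_mx ord0 i) -> box m.+1 p.
Proof.
move=> /andP[s0 s1] pm j; have := pm j; rewrite !mxE eqxx/= -natr1.
by case: (j == i); rewrite ?(mulr1, mulr0, subr0) => /andP[? ?];
  apply/andP; split; lra.
Qed.

(* By [sum_jump_le] and translation invariance, [N + 1] times the integral of the
   jump over a box is bounded independently of [N]. *)
Lemma derivative_ae i : {ae lambda, forall p : borel_rV R n.+1,
  left_derivative K w i p = right_derivative K w i p}.
Proof.
pose J (p : V) := right_derivative K w i p - left_derivative K w i p.
have J0 p : 0 <= J p by rewrite subr_ge0; exact: left_le_right.
have mJ : measurable_fun setT (J : borel_rV R n.+1 -> R).
  apply: measurable_funB; first exact: (measurable_right_derivative aw KL).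
  exact: (measurable_left_derivative aw KL).
pose g m (p : borel_rV R n.+1) := (J p * \1_(box m) p)%:E.
have g0 m p : (0 <= g m p)%E by rewrite lee_fin mulr_ge0.
have mbox m : measurable (box m : set (borel_rV R n.+1)).
  exact: measurable_closed_box.
have mg m : measurable_fun setT (g m).
  by apply/measurable_EFinP; apply: measurable_funM.
have L0 : 0 <= L.
  by have [x [Kx _]] := aw 0; exact: le_trans (KL i Kx).
(* The factor [L *+ 2] is the bound of [sum_jump_le]. The box grows by one because the translations
   used have length at most one. *)
pose C m := ((L *+ 2)%:E * lambda (box m.+1))%E.
have Cfin m : (C m < +oo)%E.
  by rewrite lte_mul_pinfty// ?lee_fin ?mulrn_wge0// lebesgue_borel_closed_box.
have C0 m : (0 <= C m)%E by rewrite mule_ge0// lee_fin mulrn_wge0.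
have gC m N : (N.+1%:R%:E * \int[lambda]_p g m p <= C m)%E.
  pose s (j : nat) : R := j%:R / N.+1%:R.
  have shift j : (\int[lambda]_p g m p =
      \int[lambda]_p g m (1 *: (p : V) + - (s j *: delta_mx ord0 i))%R)%E.
    by rewrite (ge0_integral_affine (f := g m))// expr1n invr1 mul1e.
  have -> : (N.+1%:R%:E * \int[lambda]_p g m p = \sum_(j <- iota 0 N.+1)
      \int[lambda]_p g m (1 *: (p : V) + - (s j *: delta_mx ord0 i))%R)%E.
    under eq_bigr do rewrite -shift.
    have sum_const (x : \bar R) : forall N k, (\sum_(j <- iota k N) x = N%:R%:E * x)%E.
      elim=> [|N' IH] k; first by rewrite big_nil mul0e.
      by rewrite /= big_cons IH -nat1r EFinD ge0_muleDl ?lee_fin// mul1e.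
    by rewrite sum_const.
  rewrite -ge0_integral_sum//; last first.
    move=> j; apply: (measurableT_comp (mg m)); exact: affine_measurable.
  have -> : C m = (\int[lambda]_p ((L *+ 2)%:E * (\1_(box m.+1) p)%:E))%E.
    rewrite ge0_integralZl//; first by rewrite integral_indic// setIT.
    - by apply/measurable_EFinP.
    - by rewrite lee_fin mulrn_wge0.
  have mshift (f : borel_rV R n.+1 -> \bar R) (q : V) : measurable_fun setT f ->
      measurable_fun setT (fun p : borel_rV R n.+1 => f (1 *: (p : V) + q)%R).
    by move=> mf; apply: (measurableT_comp mf); exact: affine_measurable.
  apply: ge0_le_integral => //.
  - by move=> p _; apply: sume_ge0 => j _; exact: g0.
  - by apply: emeasurable_sum => j _; exact: mshift.
  - by apply: measurable_funeM; apply/measurable_EFinP.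
  move=> p _; rewrite -EFinM.
  have gE j : g m (1 *: (p : V) + - (s j *: delta_mx ord0 i)) =
      (J (p - s j *: delta_mx ord0 i) * \1_(box m) (p - s j *: delta_mx ord0 i))%:E.
    by rewrite scale1r.
  under eq_bigr do rewrite gE.
  rewrite sumEFin lee_fin.
  apply: (@le_trans _ _ (\sum_(j < N.+1)
    J (p - s j *: delta_mx ord0 i) * \1_(box m.+1) p)).
    rewrite -[iota _ _]/(index_iota 0 N.+1) big_mkord; apply: ler_sum => j _.
    rewrite ler_wpM2l// !indicE ler_nat.
    have [|//] := boolP (_ \in box m); rewrite inE => /box_shift pm.
    rewrite mem_set//; apply: pm; rewrite divr_ge0//= ler_pdivrMr// mul1r.
    by rewrite ler_nat ltnW.
  rewrite -mulr_suml ler_wpM2r//.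
  exact: (sum_jump_le aw KL).
have int0 m : (\int[lambda]_p g m p = 0)%E.
  have I0 : (0 <= \int[lambda]_p g m p)%E by apply: integral_ge0.
  have Ifin : (\int[lambda]_p g m p \is a fin_num)%E.
    rewrite ge0_fin_numE//; apply: le_lt_trans (Cfin m).
    by have := gC m 0%N; rewrite mul1e.
  have Cf : C m \is a fin_num by rewrite ge0_fin_numE.
  apply/eqP; rewrite eq_le I0 andbT leNgt; apply/negP => I1.
  (* A positive integral contradicts the bound as soon as [N] exceeds the quotient of [C m] by
     it. *)
  move: I1 (gC m); rewrite -(fineK Ifin) -(fineK Cf) lte_fin => I1 {}gC.
  have := gC (Num.bound (fine (C m) / fine (\int[lambda]_p g m p)%E)).
  rewrite -EFinM lee_fin -ler_pdivlMr// leNgt => /negP; apply.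
  have Cd0 : 0 <= fine (C m) / fine (\int[lambda]_p g m p)%E.
    by rewrite divr_ge0 ?fine_ge0.
  by apply: lt_le_trans (archi_boundP Cd0) _; rewrite ler_nat.
have ae0 : {ae lambda, forall p : borel_rV R n.+1, forall m, g m p = 0%E}.
  apply: ae_foralln => m.
  have := (ae_eq_integral_abs lambda measurableT (mg m)).1.
  have -> : (\int[lambda]_p `|g m p| = \int[lambda]_p g m p)%E.
    by apply: eq_integral => p _; rewrite gee0_abs.
  by move=> /(_ (int0 m)); apply: filterS => p; exact.
apply: filterS ae0 => p gp.
have [m pm] : exists m, box m p.
  exists (Num.bound `|p : V|) => j; rewrite !mxE -ler_norml.
  by apply: le_trans (ler_coord_norm _ _) _; apply/ltW/archi_boundP.
have := gp m; rewrite /g indicE mem_set// mulr1 => -[] /eqP.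
by rewrite subr_eq0 => /eqP.
Qed.

(** Outside a null set the one-sided derivatives agree in every coordinate, so [argmax_derivative]
    identifies each maximizer with [gradient p]; attainment provides one. *)
Lemma argmax_ae : {ae lambda, forall p : borel_rV R n.+1,
  argmax K w p (gradient p) /\ forall x, argmax K w p x -> x = gradient p}.
Proof.
have : {ae lambda, forall p : borel_rV R n.+1, forall i : 'I_n.+1,
    left_derivative K w i p = right_derivative K w i p}.
  (* [inord] turns the finite family of coordinates into a sequence of almost sure properties. *)
  have := @ae_foralln _ _ _ lambda (fun k p => left_derivative K w (inord k) p =
    right_derivative K w (inord k) p) (fun k => derivative_ae (inord k)).
  by apply: filterS => p + i => /(_ i); rewrite inord_val.
apply: filterS => p lr.
have U x : argmax K w p x -> x = gradient p.
  move=> px; apply/rowP => i; rewrite mxE; apply/eqP; rewrite eq_le.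
  by have := argmax_derivative aw i px; rewrite lr andbC.
by split=> //; have [x px] := aw p; rewrite -(U x px).
Qed.

End gradient.

(** * Bounds on closures and integrals against set functions *)

Section within_closure.
Context {R : realType} {T : topologicalType}.

Lemma within_closure_ge (K C : set T) (f : T -> R) (c : R) :
  C `<=` K -> {within K, continuous f} -> (forall y, C y -> c <= f y) ->
  forall y, K y -> closure C y -> c <= f y.
Proof.
move=> CK /subspace_continuousP cf fc y Ky Cy; rewrite leNgt; apply/negP => fyc.
have : \forall z \near within K (nbhs y), f z < c.
  by apply: (cf y Ky [set r | r < c]); exact: lt_nbhsl.
move=> /Cy[z [Cz /(_ (CK _ Cz))]].
by rewrite ltNge fc.
Qed.

End within_closure.

Section eq_integral_set_function.
Context d (T : measurableType d) (R : realType).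

Import HBNNSimple.

(** The integral is built from simple functions, which evaluate the set function on measurable sets
    only. Hence [monge_ampere], given as a bare set function, can be exchanged for an actual
    measure. *)
Lemma eq_set_function_integral (mu nu : set T -> \bar R) (D : set T)
    (f g : T -> \bar R) :
  (forall A, measurable A -> mu A = nu A) -> {in D, f =1 g} ->
  (\int[mu]_(x in D) f x = \int[nu]_(x in D) g x)%E.
Proof.
move=> munu fg; rewrite /integral.
have -> : f \_ D = g \_ D.
  by apply/funext => x; rewrite /patch; case: ifPn => // xD; exact: fg.
have E (h : {nnsfun T >-> R}) : sintegral mu h = sintegral nu h.
  by rewrite /sintegral; apply: eq_fsbigr => x _; rewrite munu.
by congr (_ - _)%E; congr ereal_sup; apply: eq_imagel => h _; rewrite E.
Qed.

End eq_integral_set_function.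

(** * The Monge-Ampere measure as an image of Lebesgue measure *)

Section monge_ampere_pushforward.
Context {R : realType} {n : nat} (Omega : set 'rV[R]_n.+1).
Notation V := 'rV[R]_n.+1.
Notation lambda := (@lebesgue_borel R n).
Notation K := (closure Omega).
Variables (w : V -> R) (L : R).
Hypotheses (oOmega : open Omega) (aw : attained K w)
  (KL : forall x i, K x -> `|x ord0 i| <= L) (cw : {within K, continuous w}).
Notation X := (gradient K w).

(** The subgradient inequality on [Omega] extends to its closure by continuity of [w]. *)
Lemma subdifferentialE x p : Omega x ->
  subdifferential Omega w x p <-> argmax K w p x.
Proof.
move=> Ox; split=> [px|px y Oy]; last first.
  by have := px.2 y (subset_closure Oy); rewrite dotrVBr; lra.
split=> [|y Ky]; first exact: subset_closure.
have := @within_closure_ge R _ K Omega (fun y => w y - dotrV p y) (w x - dotrV p x).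
have cf : {within K, continuous (fun y => w y - dotrV p y)}.
  move=> z; apply: cvgB; first exact: cw.
  by apply: continuous_subspaceT => t; exact: continuous_dotrV.
move=> /(_ (@subset_closure _ _) cf) /(_ _ y Ky Ky) => H.
suff : w x - dotrV p x <= w y - dotrV p y by lra.
by apply: H => z Oz; have := px z Oz; rewrite dotrVBr; lra.
Qed.

(** Off the null set [N] the maximizer is unique, so [p] is a subgradient at some point of [S] in
    [Omega] exactly when [X p] is such a point. The two sets differ only inside [N]. *)
Lemma monge_ampereE (S : set (borel_rV R n.+1)) :
  monge_ampere Omega w S = lambda (X @^-1` (S `&` Omega)).
Proof.
have [N [mN N0 subN]] := argmax_ae aw KL.
have NP p : ~ N p -> argmax K w p (X p) /\ forall x, argmax K w p x -> x = X p.
  by move=> Np; apply: contrapT => h; apply: Np; exact: subN.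
have null (A B : set V) : A `<=` B `|` N -> (lebesgue_rV A <= lebesgue_rV B)%E.
  move=> AB; apply: (le_trans (le_outer_measure (@lebesgue_rV R n.+1) _ _ AB)).
  apply: (le_trans (outer_measureU2 (@lebesgue_rV R n.+1) _ _)).
  by rewrite [X in (_ + X <= _)%E](_ : _ = 0%E) ?adde0.
apply/eqP; rewrite eq_le; apply/andP; split; apply: null => p.
  move=> [x [Sx Ox] /subdifferentialE px]; have [|/NP[_ U]] := pselect (N p).
    by right.
  by left; rewrite /preimage/= -(U x) //; exact: px.
move=> [Sp Op]; have [|/NP[Xp _]] := pselect (N p); first by right.
by left; exists (X p) => //; apply/subdifferentialE.
Qed.

Lemma ma_integralE (f : V -> R) :
  measurable_fun (Omega : set (borel_rV R n.+1)) (f : borel_rV R n.+1 -> R) ->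
  (forall x, Omega x -> 0 <= f x) ->
  ma_integral Omega w f = (\int[lambda]_p ((f \_ Omega) (X p))%:E)%E.
Proof.
move=> mf f0.
have mO : measurable (Omega : set (borel_rV R n.+1)) by exact: open_borel_rV.
have mX := measurable_gradient aw KL.
pose mX_mixin := isMeasurableFun.Build _ _ _ _ _ mX.
pose mXf : {mfun (borel_rV R n.+1) >-> (borel_rV R n.+1)} := HB.pack X mX_mixin.
rewrite /ma_integral.
(* The pushforward is restricted to [Omega] because [X p] may lie on the boundary, where
   [monge_ampere] counts nothing. *)
rewrite (eq_set_function_integral (nu := mrestr (pushforward lambda mXf) mO)
    (g := fun x => (f x)%:E))//; last first.
  by move=> A mA; rewrite monge_ampereE.
transitivity (\int[pushforward lambda mXf]_(x in (Omega : set (borel_rV R n.+1)))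
  (f x)%:E)%E.
  apply: eq_measure_integral => A mA AO.
  by transitivity (lambda (X @^-1` (A `&` Omega))) => //; rewrite setIidl.
rewrite ge0_integral_pushforward//; last 2 first.
- exact/measurable_EFinP.
- by move=> x /set_mem Ox; rewrite lee_fin f0.
rewrite integral_mkcond; apply: eq_integral => p _.
rewrite /patch/=.
have -> : (p \in mXf @^-1` Omega) = (X p \in Omega) by apply/idP/idP; rewrite !inE.
by case: ifP.
Qed.

End monge_ampere_pushforward.

(** * Danskin's formula *)

Section danskin.
Context {R : realType} {n : nat} (K : set 'rV[R]_n).
Variables (u v : 'rV[R]_n -> R).
Hypotheses (cK : compact K) (clK : closed K)
  (cu : {within K, continuous u}) (cv : {within K, continuous v}).
Notation H t := (legendre K (fun x => u x + t * v x)).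

Lemma within_continuous_perturbation t :
  {within K, continuous (fun x => u x + t * v x)}.
Proof.
move=> x; apply: cvgD; first exact: cu.
by apply: cvgM; [exact: cvg_cst|exact: cv].
Qed.

(** Using each maximizer as a competitor in the other problem places the quotient between [- v x]
    and [- v y]. *)
Lemma legendre_quotient t p x y : t != 0 ->
  argmax K u p x -> argmax K (fun x => u x + t * v x) p y ->
  `|(H t p - legendre K u p) / t - (- v x)| <= `|v y - v x|.
Proof.
move=> t0 px py; rewrite (legendre_argmax px) (legendre_argmax py).
have := px.2 y py.1; have := py.2 x px.1 => h1 h2.
set q := _ / t.
have qt : q * t = dotrV p y - (u y + t * v y) - (dotrV p x - u x) by rewrite /q divfK.
have : t < 0 \/ 0 < t by apply/orP; rewrite -neq_lt.
have b1 : - v x * t <= q * t by rewrite qt; lra.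
have b2 : q * t <= - v y * t by rewrite qt; lra.
move=> [tn|tp].
  rewrite ler_nM2r// in b1; rewrite ler_nM2r// in b2.
  by rewrite distrC [leRHS]ger0_norm ?ger0_norm; lra.
rewrite ler_pM2r// in b1; rewrite ler_pM2r// in b2.
by rewrite [leRHS]distrC [leRHS]ger0_norm ?ger0_norm; lra.
Qed.

(** On the compact set [C] of points where [v] differs from [v x] by at least [e], uniqueness keeps
    the objective a gap [d] below its maximum. A small perturbation cannot close this gap, so the
    perturbed maximizers avoid [C] and [legendre_quotient] concludes. *)
Lemma danskin p x : argmax K u p x -> (forall y, argmax K u p y -> y = x) ->
  (H t p - legendre K u p) / t @[t --> (0 : R)^'] --> - v x.
Proof.
move=> px pU.
have K0 : K !=set0 by exists x; exact: px.1.
have att t : attained K (fun x => u x + t * v x).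
  by apply: attained_continuous => //; exact: within_continuous_perturbation.
apply/cvgrPdist_lt => e e0.
pose C := K `&` [set y | e <= `|v y - v x|].
have [d d0 Cd] : exists2 d, 0 < d & forall y, C y ->
    dotrV p y - u y <= dotrV p x - u x - d.
  have [[c0 Cc0]|C0] := pselect (C !=set0); last first.
    by exists 1 => // y Cy; exfalso; apply: C0; exists y.
  have cdist : {within K, continuous (fun y => `|v y - v x|)}.
    by move=> z; apply: cvg_norm; apply: cvgB; [exact: cv|exact: cvg_cst].
  have clC : closed C.
    move=> y Cy; have Ky : K y by apply: clK; apply: closureS Cy => ? [].
    split=> //; apply: (within_closure_ge _ cdist _ Ky Cy); first by move=> ? [].
    by move=> z [].
  have cC : compact C by apply: (subclosed_compact clC cK) => ? [].
  have cf : {within C, continuous (fun y => dotrV p y - u y)}.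
    apply: (continuous_subspaceW (A := C) (B := K)); first by move=> ? [].
    move=> z; apply: cvgB; last exact: cu.
    by apply: continuous_subspaceT => ?; exact: continuous_dotrV.
  have [|c /set_mem Cc cmax] := EVT_max_rV _ cC cf; first by exists c0.
  exists (dotrV p x - u x - (dotrV p c - u c)).
    rewrite subr_gt0 lt_neqAle; apply/andP; split; last exact: px.2 _ Cc.1.
    (* Equality would make [c] a second maximizer, hence equal to [x], which is not in [C]. *)
    apply/eqP => E.
    have cx : c = x.
      by apply: pU; split=> [|y Ky]; [exact: Cc.1|rewrite E; exact: px.2].
    by have := Cc.2; rewrite /= cx subrr normr0 leNgt e0.
  by move=> y Cy; have := cmax y (mem_set Cy); lra.
have [B B0 vB] : exists2 B, 0 < B & forall y, K y -> `|v y| <= B.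
  have cnv : {within K, continuous (fun y => `|v y|)}.
    by move=> z; apply: cvg_norm; exact: cv.
  have [c _ cmax] := EVT_max_rV K0 cK cnv.
  exists (`|v c| + 1) => [|y Ky]; first by rewrite ltr_wpDl.
  by apply: (@le_trans _ _ `|v c|); [apply: cmax; rewrite inE|rewrite lerDl].
near=> t.
have t0 : t != 0 by near: t; exact: nbhs_dnbhs_neq.
have [y py] := att t p.
rewrite distrC (le_lt_trans (legendre_quotient t0 px py))// ltNge; apply/negP => Cy.
have := Cd y (conj py.1 Cy); have := py.2 x px.1.
suff : t * v y - t * v x > - d by lra.
(* Since [|v y - v x|] is at most [2 B], the perturbation then contributes less than [d]. *)
have td : `|t| < d / (B *+ 2).
  by near: t; apply: dnbhs0_lt; rewrite divr_gt0// mulrn_wgt0.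
rewrite ltr_pdivlMr ?mulrn_wgt0// in td.
rewrite -mulrBr; suff : `|t * (v y - v x)| < d by rewrite ltr_norml => /andP[].
apply: le_lt_trans td; rewrite normrM ler_wpM2l// mulr2n.
by rewrite (le_trans (ler_normB _ _))// lerD// vB//; [exact: py.1|exact: px.1].
Unshelve. all: by end_near. Qed.

End danskin.

(** * Derivative of the dual energy *)

Section energy_variation.
Context {R : realType} {n : nat} (Omega : set 'rV[R]_n.+1).
Notation V := 'rV[R]_n.+1.
Notation lambda := (@lebesgue_borel R n).
Notation K := (closure Omega).
Hypotheses (oOmega : open Omega) (bOmega : bounded_set Omega)
  (Omega0 : Omega !=set0).

Lemma closure_nonempty : K !=set0.
Proof. by have [x Ox] := Omega0; exists x; exact: subset_closure. Qed.

Lemma closure_bounded : exists L : R, forall x : V, K x -> `|x| <= L.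
Proof.
have [M [Mreal OM]] := bOmega; exists (M + 1) => x Kx.
have cN : {within K, continuous (fun y : V => - `|y|)}.
  apply: continuous_subspaceT; apply: (@lipschitz_continuous _ _ _ 1) => y z.
  by rewrite mul1r -opprD normrN; exact: ler_dist_dist.
rewrite -lerN2; apply: (within_closure_ge (@subset_closure _ _) cN _ Kx Kx).
by move=> y Oy; rewrite lerN2; apply: OM => //; rewrite ltrDl.
Qed.

Lemma closure_coord_bounded :
  exists L : R, forall (x : V) i, K x -> `|x ord0 i| <= L.
Proof.
have [L KL] := closure_bounded; exists L => x i Kx.
by apply: le_trans (ler_coord_norm _ _) _; exact: KL.
Qed.

Lemma compact_closure_bounded : compact K.
Proof.
apply: bounded_closed_compact; last exact: closed_closure.
have [L KL] := closure_bounded; exists L; split; first exact: num_real.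
by move=> M LM x Kx; apply: le_trans (KL x Kx) (ltW LM).
Qed.

(** Maximizers may lie on the boundary, outside the reach of the Monge-Ampere measure; zero boundary
    values make the restriction to [Omega] harmless there. *)
Lemma restrict_boundary0 (w : V -> R) x :
  (forall y, boundary Omega y -> w y = 0) -> K x -> (w \_ Omega) x = w x.
Proof.
move=> wb Kx; rewrite /patch; case: ifPn => // /negP XO; rewrite wb//.
by split=> // /interior_subset XO'; apply: XO; rewrite inE.
Qed.

Lemma measurable_within_closure (w : V -> R) : {within K, continuous w} ->
  measurable_fun (Omega : set (borel_rV R n.+1)) (w : borel_rV R n.+1 -> R).
Proof.
move=> cw; apply: within_continuous_borel_rV => //.
rewrite -continuous_open_subspace//.
by apply: continuous_subspaceW cw; exact: subset_closure.
Qed.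

Lemma attained_closure w : {within K, continuous w} -> attained K w.
Proof.
apply: attained_continuous; [exact: compact_closure_bounded|exact: closure_nonempty].
Qed.

Lemma attained0 : attained K (fun=> 0).
Proof.
by apply: attained_closure; apply: continuous_subspaceT; exact: cst_continuous.
Qed.

Definition excess (w : V -> R) (p : V) : R := legendre K w p - legendre K (fun=> 0) p.

Definition dual_energy (w : V -> R) : \bar R := (\int[lambda]_p (excess w p)%:E)%E.

Lemma measurable_excess w : attained K w ->
  measurable_fun setT (excess w : borel_rV R n.+1 -> R).
Proof.
move=> aw; have [L KL] := closure_coord_bounded.
apply: measurable_funB; apply: continuous_borel_rV.
  exact: (continuous_legendre aw KL).
exact: (continuous_legendre attained0 KL).
Qed.

Lemma legendre_le (w1 w2 : V -> R) p : attained K w1 -> attained K w2 ->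
  (forall x, K x -> w1 x <= w2 x) -> legendre K w2 p <= legendre K w1 p.
Proof.
move=> a1 a2 w12; have [x px] := a2 p; rewrite (legendre_argmax px).
by have := le_legendre p a1 px.1; have := w12 x px.1; lra.
Qed.

Lemma excess_ge0 w p : attained K w -> (forall x, K x -> w x <= 0) ->
  0 <= excess w p.
Proof.
by move=> aw w0; rewrite subr_ge0; apply: legendre_le => //; exact: attained0.
Qed.

Variables u v : V -> R.
Hypotheses (cu : {within K, continuous u}) (cv : {within K, continuous v})
  (v0 : forall x, K x -> v x <= 0) (vb : forall x, boundary Omega x -> v x = 0).
Notation perturb t := (fun x => u x + t * v x).
(** These two facts stay abstract because they have different proofs in the two applications: by
    scaling when [v = u], and through the convex envelope for general [v]. *)
Hypotheses
  (excess_pert_ge0 : forall t p, `|t| <= 1 -> 0 <= excess (perturb t) p)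
  (dual_energy_lty : (dual_energy (perturb 1) < +oo)%E).

Let att t : attained K (perturb t).
Proof. by apply: attained_closure; exact: within_continuous_perturbation. Qed.

Let attu : attained K u. Proof. exact: attained_closure. Qed.

Let pert0 : perturb 0 = u.
Proof. by apply/funext => x; rewrite mul0r addr0. Qed.

Let excess_le1 t p : t <= 1 -> excess (perturb t) p <= excess (perturb 1) p.
Proof.
move=> t1; rewrite lerD2r; apply: legendre_le => // x Kx.
by rewrite lerD2l ler_wnM2r// v0.
Qed.

Lemma excess_quotient_bound t p : t != 0 -> `|t| <= 1 ->
  `|(excess (perturb t) p - excess u p) / t| <= excess (perturb 1) p.
Proof.
move=> t0 t1.
rewrite /excess [X in X / t](_ : _ = legendre K (perturb t) p - legendre K u p);
  last by lra.
have := excess_pert_ge0 p (_ : `|0| <= 1); rewrite normr0 ler01 pert0 => /(_ isT).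
rewrite /excess; set h := legendre K (fun=> 0) p.
have [x px] := attu p; have [y py] := att t p.
have Hx := legendre_argmax px; have Hy := legendre_argmax py.
have h1x := le_legendre p (att 1) px.1; have h1y := le_legendre p (att 1) py.1.
have htx := le_legendre p (att t) px.1; have huy := le_legendre p attu py.1.
have vx := v0 px.1; have vy := v0 py.1.
move: Hx Hy h1x h1y htx huy.
set H0 := legendre K u p; set H1 := legendre K (perturb 1) p.
set Ht := legendre K (perturb t) p => Hx Hy h1x h1y htx huy h0.
(* A convex nondecreasing function of [t] has slopes from [0] bounded by the slope over [[0, 1]];
   here this follows by testing [x] and [y] at the times [0], [t] and [1]. By [h0] the bound
   [H1 - H0] is at most [H1 - h]. *)
suff : 0 <= (Ht - H0) / t <= H1 - H0 by move=> /andP[q0 q1]; rewrite ger0_norm//; lra.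
have : t < 0 \/ 0 < t by apply/orP; rewrite -neq_lt.
move: t1; rewrite ler_norml => /andP[t1 t2] [tn|tp].
  rewrite ler_ndivlMr// ler_ndivrMr// mul0r; apply/andP; split; first by nra.
  nra.
rewrite ler_pdivlMr// ler_pdivrMr// mul0r; apply/andP; split; first by nra.
nra.
Qed.

Lemma excess_integrable t : `|t| <= 1 ->
  lambda.-integrable setT (fun p : borel_rV R n.+1 => (excess (perturb t) p)%:E).
Proof.
move=> t1; apply/integrableP; split.
  by apply/measurable_EFinP; apply: measurable_excess; exact: att.
apply: le_lt_trans dual_energy_lty; apply: ge0_le_integral => //.
- apply: measurableT_comp => //.
  by apply/measurable_EFinP; apply: measurable_excess; exact: att.
- by apply/measurable_EFinP; apply: measurable_excess; exact: att.
- move=> p _; rewrite lee_fin ger0_norm ?excess_pert_ge0//; apply: excess_le1.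
  exact: le_trans (ler_norm _) t1.
Qed.

Notation G t := (fine (dual_energy (perturb t))).
Notation X := (gradient K u).

Lemma excess_quotient_cvg (s : R^nat) : (forall k, s k != 0) -> s @ \oo --> (0 : R) ->
  {ae lambda, forall p : borel_rV R n.+1,
    (((excess (perturb (s k)) p - excess u p) / s k)%:E @[k --> \oo] -->
     (((fun x => - v x) \_ Omega) (X p))%:E)}.
Proof.
move=> sk0 s0; have [L KL] := closure_coord_bounded.
apply: filterS (argmax_ae attu KL) => p [Xp U].
rewrite restrict_boundary0; last 2 first.
- by move=> y /vb ->; rewrite oppr0.
- exact: Xp.1.
apply/fine_cvgP; split; first exact: nearW.
have := danskin compact_closure_bounded (@closed_closure _ _) cu cv Xp U.
move=> /cvgr_dnbhsP/(_ s (conj sk0 s0)); apply: cvg_trans; apply: near_eq_cvg.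
by apply: nearW => k /=; congr (_ / _); rewrite /excess; lra.
Qed.

Lemma measurable_pairing :
  measurable_fun setT (fun p : borel_rV R n.+1 => ((fun x => - v x) \_ Omega) (X p)).
Proof.
have [L KL] := closure_coord_bounded.
apply: (measurableT_comp (f := (fun x => - v x) \_ Omega : borel_rV R n.+1 -> R)).
  apply/(measurable_restrictT _ _).1; first exact: open_borel_rV.
  by apply: measurableT_comp => //; exact: measurable_within_closure.
exact: (measurable_gradient attu KL).
Qed.

Lemma ma_integral_pairing : ma_integral Omega u (fun x => - v x) =
  (\int[lambda]_p (((fun x => - v x) \_ Omega) (X p))%:E)%E.
Proof.
have [L KL] := closure_coord_bounded.
apply: (ma_integralE oOmega attu KL cu) => [|x Ox].
  by apply: measurableT_comp => //; exact: measurable_within_closure.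
by rewrite oppr_ge0 v0//; exact: subset_closure.
Qed.

(** Dominated convergence applies along sequences in [[-1, 1]] tending to [0], with dominating
    function [excess (perturb 1)]; the sequential criterion then gives the limit at [0]. *)
Lemma dual_energy_derivative :
  ma_integral Omega u (fun x => - v x) \is a fin_num /\
  is_derive (0 : R) (1 : R) (fun t => G t)
    (fine (ma_integral Omega u (fun x => - v x))).
Proof.
set D := fine _.
have dct (s : R^nat) : (forall k, s k != 0) -> (forall k, `|s k| <= 1) ->
    s @ \oo --> (0 : R) ->
    ma_integral Omega u (fun x => - v x) \is a fin_num /\
    (G (s k) - G 0) / s k @[k --> \oo] --> D.
  move=> sk0 sk1 s0.
  have := @dominated_convergence _ _ _ lambda setT measurableT
    (fun k p => ((excess (perturb (s k)) p - excess u p) / s k)%:E)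
    (fun p => (((fun x => - v x) \_ Omega) (X p))%:E)
    (fun p => (excess (perturb 1) p)%:E).
  case.
  - move=> k; apply/measurable_EFinP; apply: measurable_funM => //.
    apply: measurable_funB; first exact: measurable_excess (att _).
    exact: measurable_excess attu.
  - by apply/measurable_EFinP; exact: measurable_pairing.
  - by apply: filterS (excess_quotient_cvg sk0 s0) => p + _.
  - by apply: excess_integrable; rewrite normr1.
  - by apply: nearW => p k _; rewrite lee_fin; exact: excess_quotient_bound.
  move=> iD _; rewrite -ma_integral_pairing => cvgD.
  have fD : ma_integral Omega u (fun x => - v x) \is a fin_num.
    by rewrite ma_integral_pairing; exact: integrable_fin_num.
  split=> //; move: cvgD; rewrite -(fineK fD) => /fine_cvg; apply: cvg_trans.
  apply: near_eq_cvg; apply: nearW => k /=.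
  rewrite -/(Rintegral lambda setT
    (fun p => (excess (perturb (s k)) p - excess u p) / s k)).
  have n01 : `|0 : R| <= 1 by rewrite normr0.
  have Iu : lambda.-integrable setT (fun p : borel_rV R n.+1 => (excess u p)%:E).
    by have := excess_integrable n01; rewrite pert0.
  have Is := excess_integrable (sk1 k).
  rewrite RintegralZr//; last exact: (integrableB measurableT Is Iu).
  by rewrite RintegralB// /dual_energy pert0.
(* Finiteness follows from any admissible sequence, for instance the harmonic one. *)
have fD : ma_integral Omega u (fun x => - v x) \is a fin_num.
  have h0 k : @harmonic R k != 0 by rewrite gt_eqF// harmonic_gt0.
  have h1 k : `|@harmonic R k| <= 1 by rewrite ger0_norm//= invf_le1// ler1n.
  by have [] := dct harmonic h0 h1 cvg_harmonic.
split=> //.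
have cvgG : (G t - G 0) / t @[t --> (0 : R)^'] --> D.
  apply/cvgr_dnbhsP => s [sk0 s0].
  (* Dropping the first [N] terms brings the sequence into [[-1, 1]] without changing the limit. *)
  have [N _ sN] : \forall k \near \oo, `|0 - s k| <= 1.
    by move/cvgrPdist_le : s0; exact.
  rewrite -(cvg_shiftn N).
  have [] := dct (fun k => s (k + N)%N) => //.
    by move=> k; rewrite -normrN -sub0r; apply: sN => /=; rewrite leq_addl.
  by rewrite (cvg_shiftn N s).
have E : (fun h : R => h^-1 *: (((fun t => G t) \o shift 0) (h *: 1) - G 0)) =
    (fun t => (G t - G 0) / t).
  by apply/funext => h /=; rewrite addr0 [h *: 1]mulr1 mulrC.
apply: DeriveDef.
  by rewrite /derivable E; apply/cvg_ex; exists D.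
by rewrite /derive E; apply/cvg_lim.
Qed.

End energy_variation.

(** * Convexity up to the closure and exit points of rays *)

Section convexity.
Context {R : realType} {n : nat}.
Notation V := 'rV[R]_n.
Implicit Types (D Omega K : set V) (f w : V -> R) (x y z : V) (t : R).

Lemma convex_functionP D f : convex_function D f <->
  forall t x y, 0 <= t <= 1 -> D x -> D y ->
    f (t *: x + (1 - t) *: y) <= t * f x + (1 - t) * f y.
Proof.
split=> [cf t x y /andP[t0 t1] Dx Dy|cf t x y /set_mem Dx /set_mem Dy].
  by have := cf (Itv01 t0 t1) x y (mem_set Dx) (mem_set Dy).
by apply: cf => //; rewrite ge0 le1.
Qed.

Lemma convex_setP D : convex_set D ->
  forall t x y, 0 <= t <= 1 -> D x -> D y -> D (t *: x + (1 - t) *: y).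
Proof.
move=> cD t x y /andP[t0 t1] Dx Dy.
by have /set_mem := cD x y (Itv01 t0 t1) (mem_set Dx) (mem_set Dy).
Qed.

Lemma closure_ball_ex Omega x e : 0 < e -> closure Omega x ->
  exists2 y, Omega y & `|x - y| < e.
Proof.
move=> e0 /(_ (ball x e)); case; first exact: nbhsx_ballx.
by move=> y [Oy]; rewrite -ball_normE; exists y.
Qed.

Lemma within_continuous_ball K f x e : {within K, continuous f} -> K x -> 0 < e ->
  exists2 d, 0 < d & forall y, K y -> `|x - y| < d -> `|f x - f y| < e.
Proof.
move=> /subspace_continuousP cf Kx e0.
have := cf x Kx (ball (f x) e) (nbhsx_ballx _ _ e0).
move=> /(@nbhs_normP R _ x _).1 [d d0 xd].
by exists d => // y Ky xy; have := xd y xy Ky; rewrite -ball_normE.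
Qed.

Lemma conv_norm_lt t x y x' y' e : 0 <= t <= 1 -> `|x - x'| < e -> `|y - y'| < e ->
  `|(t *: x + (1 - t) *: y) - (t *: x' + (1 - t) *: y')| < e.
Proof.
move=> /andP[t0 t1] xx yy.
rewrite opprD addrACA -!scalerBr (le_lt_trans (ler_normD _ _))//.
rewrite !normrZ (ger0_norm t0) ger0_norm ?subr_ge0//.
have := ler_wpM2l t0 (ltW xx).
(* Strictness comes from the second term, of weight [1 - t], except for [t = 1], where the first
   term supplies it. *)
have [->|t1'] := eqVneq t 1.
  by rewrite subrr !mul0r addr0 mul1r.
have t1p : 0 < 1 - t by rewrite subr_gt0 lt_neqAle t1'.
by move: yy; rewrite -(ltr_pM2l t1p); lra.
Qed.

Variable Omega : set V.
Hypothesis cvxOmega : convex_set Omega.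
Notation K := (closure Omega).

Lemma closure_convex t x y : 0 <= t <= 1 -> K x -> K y -> K (t *: x + (1 - t) *: y).
Proof.
move=> t01 Kx Ky B /(@nbhs_normP R _ _ B).1[e e0 eB].
have [x' Ox xx] := closure_ball_ex e0 Kx.
have [y' Oy yy] := closure_ball_ex e0 Ky.
exists (t *: x' + (1 - t) *: y'); split; first exact: convex_setP.
by apply: eB; exact: conv_norm_lt.
Qed.

(** The endpoints are approximated from [Omega]. The values at the endpoints and at the combination
    each move by less than [e / 2], for a total error below [e]. *)
Lemma convex_function_closure w : {within K, continuous w} ->
  convex_function Omega w -> convex_function K w.
Proof.
move=> cw /convex_functionP cvw; apply/convex_functionP => t x y t01 Kx Ky.
apply/ler_addgt0Pr => e e0.
have Kz := closure_convex t01 Kx Ky.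
have e20 : 0 < e / 2 by rewrite divr_gt0.
have [dx dx0 xd] := within_continuous_ball cw Kx e20.
have [dy dy0 yd] := within_continuous_ball cw Ky e20.
have [dz dz0 zd] := within_continuous_ball cw Kz e20.
pose d := Num.min dx (Num.min dy dz).
have d0 : 0 < d by rewrite !lt_min dx0 dy0 dz0.
have [x' Ox xx] := closure_ball_ex d0 Kx.
have [y' Oy yy] := closure_ball_ex d0 Ky.
have zz := conv_norm_lt t01 xx yy.
move: xx yy zz; rewrite !lt_min => /and3P[xx _ _] /and3P[_ yy _] /and3P[_ _ zz].
have {xd}xd := xd x' (subset_closure Ox) xx.
have {yd}yd := yd y' (subset_closure Oy) yy.
have {zd}zd := zd _ (subset_closure (convex_setP cvxOmega t01 Ox Oy)) zz.
have := cvw t x' y' t01 Ox Oy.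
move: xd yd zd; rewrite !ltr_norml => /andP[xd _] /andP[yd _] /andP[_ zd].
case/andP: t01 => t0 t1; have t1' : 0 <= 1 - t by rewrite subr_ge0.
have := ler_wpM2l t0 (ltW xd); have := ler_wpM2l t1' (ltW yd).
by lra.
Qed.

Hypotheses (oOmega : open Omega) (bOmega : bounded_set Omega).

(** The exit parameter is the supremum of the parameters whose point is in [Omega]: boundedness
    makes it finite, openness excludes its point from [Omega], and approximation from below puts
    that point in the closure. *)
Lemma boundary_ray x (e : V) : e != 0 -> Omega x ->
  exists2 s, 0 < s & boundary Omega (x + s *: e).
Proof.
move=> e0 Ox; have ne0 : 0 < `|e| by rewrite normr_gt0.
pose S := [set s : R | 0 <= s /\ Omega (x + s *: e)].
have S0 : S 0 by split; rewrite // scale0r addr0.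
have [M [Mreal OM]] := bOmega.
have ubS : has_ubound S.
  exists ((`|M + 1| + `|x|) / `|e|) => s [s0 Os].
  rewrite ler_pdivlMr// -{1}(ger0_norm s0) -normrZ.
  rewrite -[s *: e](addKr x) addrC (le_trans (ler_normB _ _))//.
  rewrite lerD2r; apply: (le_trans (OM (M + 1) _ _ Os)); rewrite ?ltrDl//.
  exact: ler_norm.
have supS : has_sup S by split=> //; exists 0.
have sS0 : 0 <= sup S by exact: ub_le_sup.
have notO : ~ Omega (x + sup S *: e).
  move=> Os; have := oOmega; rewrite openE => /(_ _ Os).
  move=> /(@nbhs_normP R _ _ _).1 [d /= d0 dO].
  (* A further move of length [d / 2] would remain in the ball around the exit point, contradicting
     the supremum. *)
  have d2 : 0 < d / 2 / `|e| by rewrite !divr_gt0.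
  have : S (sup S + d / 2 / `|e|).
    split; first by rewrite addr_ge0// ltW.
    apply: dO => /=; rewrite opprD addrA [X in X - _]addrC.
    rewrite scalerDl opprD.
    rewrite (_ : _ + _ + _ = - ((d / 2 / `|e|) *: e)); last first.
      by apply/rowP => j; rewrite !mxE; ring.
    rewrite normrN normrZ (gtr0_norm d2) divfK ?gt_eqF//.
    by rewrite ltr_pdivrMr// mulr_natr mulr2n ltrDl.
  by move/(ub_le_sup ubS); rewrite gerDl leNgt d2.
exists (sup S).
  rewrite lt_neqAle sS0 andbT; apply/eqP => s0.
  by apply: notO; rewrite -s0 scale0r addr0.
split; last by move=> /interior_subset.
move=> B /(@nbhs_normP R _ _ B).1[d /= d0 dB].
have d2 : 0 < d / `|e| by rewrite divr_gt0.
have [s [s0 Os] sd] := sup_adherent d2 supS.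
exists (x + s *: e); split=> //; apply: dB => /=.
rewrite opprD addrACA subrr add0r -scalerBl normrZ.
rewrite -ltr_pdivlMr// ger0_norm; first by lra.
by rewrite subr_ge0; exact: ub_le_sup.
Qed.

End convexity.

(** * Maximum principle for convex functions *)

Section boundary_values.
Context {R : realType} {n : nat} (Omega : set 'rV[R]_n.+1).
Notation K := (closure Omega).
Hypotheses (oOmega : open Omega) (cvxOmega : convex_set Omega)
  (bOmega : bounded_set Omega).

(** Two opposite rays from an interior point reach the boundary, so the point is a convex
    combination of boundary points. *)
Lemma convex_le0 (f : 'rV[R]_n.+1 -> R) : convex_function K f ->
  (forall x, boundary Omega x -> f x <= 0) -> forall x, K x -> f x <= 0.
Proof.
move=> /convex_functionP cf fb x Kx.
have [Ox|Ox] := pselect (Omega x); last first.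
  by apply: fb; split=> // /interior_subset.
have e0 : const_mx 1 != 0 :> 'rV[R]_n.+1.
  by apply/eqP => /rowP/(_ ord0)/eqP; rewrite !mxE oner_eq0.
have [s s0 bs] := boundary_ray oOmega bOmega e0 Ox.
have Ne0 : - const_mx 1 != 0 :> 'rV[R]_n.+1 by rewrite oppr_eq0.
have [r r0 br] := boundary_ray oOmega bOmega Ne0 Ox.
have sr0 : 0 < s + r by rewrite addr_gt0.
have t01 : 0 <= r / (s + r) <= 1.
  apply/andP; split; first by apply: divr_ge0; exact: ltW.
  by rewrite ler_pdivrMr// mul1r lerDr ltW.
have := cf _ _ _ t01 (proj1 bs) (proj1 br).
rewrite [X in f X <= _ -> _](_ : _ = x); last first.
  by apply/rowP => j; rewrite !mxE; field; rewrite gt_eqF.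
move=> /le_trans; apply; move: t01 => /andP[t0 t1].
rewrite -[leRHS]addr0; apply: lerD; apply: mulr_ge0_le0; rewrite ?subr_ge0//.
- exact: fb.
- exact: fb.
Qed.

End boundary_values.

(** * Homogeneity of the dual energy *)

Section scaling.
Context {R : realType} {n : nat} (Omega : set 'rV[R]_n.+1).
Notation V := 'rV[R]_n.+1.
Notation lambda := (@lebesgue_borel R n).
Notation K := (closure Omega).
Hypotheses (bOmega : bounded_set Omega) (Omega0 : Omega !=set0).
Implicit Types (w : V -> R) (p : V) (c : R).

Lemma argmax_scale w c p x : 0 < c ->
  argmax K w (c^-1 *: p) x -> argmax K (fun x => c * w x) p x.
Proof.
move=> c0 [Kx px]; split=> // y Ky.
have := px y Ky; rewrite !dotrVZl -(ler_pM2l c0).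
by rewrite !mulrBr !mulrA divff ?gt_eqF// !mul1r.
Qed.

Lemma attained_scale w c : 0 < c -> attained K w -> attained K (fun x => c * w x).
Proof.
by move=> c0 aw p; have [x px] := aw (c^-1 *: p); exists x; exact: argmax_scale.
Qed.

Lemma legendre_scale w c p : 0 < c -> attained K w ->
  legendre K (fun x => c * w x) p = c * legendre K w (c^-1 *: p).
Proof.
move=> c0 aw; have [x px] := aw (c^-1 *: p).
rewrite (legendre_argmax (argmax_scale c0 px)) (legendre_argmax px) dotrVZl.
by rewrite mulrBr mulrA divff ?gt_eqF// mul1r.
Qed.

Lemma excess_scale w c p : 0 < c -> attained K w ->
  excess Omega (fun x => c * w x) p = c * excess Omega w (c^-1 *: p).
Proof.
move=> c0 aw; have a0 := attained0 bOmega Omega0.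
rewrite /excess mulrBr -legendre_scale//; congr (_ - _).
(* The support function is the transform of [0], and [c * 0 = 0] makes it homogeneous of degree
   one. *)
rewrite -(legendre_scale p c0 a0); congr legendre.
by apply/funext => x; rewrite mulr0.
Qed.

(** One factor [c] comes from [excess_scale] and [c ^ n.+1] from the substitution of [c^-1 *: p]. *)
Lemma dual_energy_scale w c : 0 < c -> attained K w ->
  (forall p, 0 <= excess Omega w p) ->
  (dual_energy Omega (fun x => (c * w x)%R) = (c ^+ n.+2)%:E * dual_energy Omega w)%E.
Proof.
move=> c0 aw w0; have mw := measurable_excess bOmega Omega0 aw.
have ci0 : 0 < c^-1 by rewrite invr_gt0.
have := @ge0_integral_affine R n (fun p => (excess Omega w p)%:E) c^-1 0 ci0.
move=> /(_ ((measurable_EFinP _ _).2 mw) (fun p => w0 p)).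
rewrite exprVn invrK => E; rewrite exprS EFinM -muleA -E.
rewrite /dual_energy -ge0_integralZl//; last 3 first.
- apply/measurable_EFinP; apply: (measurableT_comp mw); exact: affine_measurable.
- by move=> p _; rewrite lee_fin.
- by rewrite lee_fin ltW.
by apply: eq_integral => p _; rewrite addr0 excess_scale// EFinM.
Qed.

(** The transform is convex in the function, and [u + v] is the midpoint of [2 u] and [2 v]. *)
Lemma excess_midpoint u v p : attained K (fun x => u x + v x) ->
  attained K u -> attained K v ->
  excess Omega (fun x => u x + v x) p <=
    2^-1 * (excess Omega (fun x => 2 * u x) p + excess Omega (fun x => 2 * v x) p).
Proof.
move=> auv au av; have [x px] := auv p; rewrite /excess (legendre_argmax px).
have := le_legendre p (attained_scale (ltr0Sn R 1) au) px.1.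
by have := le_legendre p (attained_scale (ltr0Sn R 1) av) px.1; lra.
Qed.

End scaling.

(** This is the finite energy class without its energy bound, which for convex envelopes is obtained
    only at the end. *)
Definition convex_zero_boundary {R : realType} {n : nat}
    (Omega : set 'rV[R]_n) (w : 'rV[R]_n -> R) : Prop :=
  [/\ {within closure Omega, continuous w}, convex_function Omega w &
      forall x, boundary Omega x -> w x = 0].

(** * The energy as a multiple of the dual energy *)

Section energy_formula.
Context {R : realType} {n : nat} (Omega : set 'rV[R]_n.+1).
Notation V := 'rV[R]_n.+1.
Notation lambda := (@lebesgue_borel R n).
Notation K := (closure Omega).
Hypotheses (oOmega : open Omega) (Omega0 : Omega !=set0)
  (cvxOmega : convex_set Omega) (bOmega : bounded_set Omega).

Lemma convex_zero_boundary_le0 w : convex_zero_boundary Omega w ->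
  forall x, K x -> w x <= 0.
Proof.
move=> [cw vw wb]; apply: (convex_le0 oOmega bOmega).
  exact: convex_function_closure.
by move=> x /wb ->.
Qed.

Variable w : V -> R.
Hypothesis Ww : convex_zero_boundary Omega w.

Let cw : {within K, continuous w}. Proof. by case: Ww. Qed.
Let wb x : boundary Omega x -> w x = 0. Proof. by case: Ww => _ _; exact. Qed.
Let w0 x : K x -> w x <= 0. Proof. exact: convex_zero_boundary_le0. Qed.
Let aw : attained K w. Proof. exact: attained_closure. Qed.
Let excess_w0 p : 0 <= excess Omega w p. Proof. exact: excess_ge0. Qed.

Lemma dual_energy_ge0 : (0 <= dual_energy Omega w)%E.
Proof. by apply: integral_ge0 => p _; rewrite lee_fin. Qed.

Lemma dual_energy_scale_lty c : 0 < c -> (dual_energy Omega w < +oo)%E ->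
  (dual_energy Omega (fun x => (c * w x)%R) < +oo)%E.
Proof.
move=> c0 wfin; rewrite dual_energy_scale//.
by rewrite lte_mul_pinfty// lee_fin exprn_ge0// ltW.
Qed.

(** Since [X p] lies in [K], its dot product with [p] is at most the support function, so the excess
    at [p] is at most [- w (X p)]. *)
Lemma dual_energy_lty : (ma_integral Omega w (fun x => `|w x|%R) < +oo)%E ->
  (dual_energy Omega w < +oo)%E.
Proof.
have -> : ma_integral Omega w (fun x => `|w x|) = ma_integral Omega w (fun x => - w x).
  apply: eq_set_function_integral => // x; rewrite inE => Ox.
  by rewrite ler0_norm// w0//; exact: subset_closure.
rewrite (ma_integral_pairing oOmega bOmega Omega0 cw cw w0).
apply: le_lt_trans; have [L KL] := closure_coord_bounded bOmega.
apply: ae_ge0_le_integral => //.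
- by move=> p _; rewrite lee_fin.
- by apply/measurable_EFinP; apply: measurable_excess.
- move=> p _; rewrite lee_fin /patch; case: ifPn => //; rewrite inE => Op.
  by rewrite oppr_ge0 w0//; exact: subset_closure.
- by apply/measurable_EFinP; apply: measurable_pairing.
apply: filterS (argmax_ae aw KL) => p [Xp _] _.
rewrite lee_fin restrict_boundary0; last 2 first.
- by move=> y /wb ->; rewrite oppr0.
- exact: Xp.1.
rewrite /excess (legendre_argmax Xp).
by have := le_legendre p (attained0 bOmega Omega0) Xp.1; lra.
Qed.

Lemma energy_formula : (dual_energy Omega w < +oo)%E ->
  ma_energy Omega w \is a fin_num /\
  fine (ma_energy Omega w) = n.+2%:R * fine (dual_energy Omega w).
Proof.
move=> wfin.
have pertE t : (fun x => w x + t * w x) = (fun x => (1 + t) * w x).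
  by apply/funext => x; rewrite mulrDl mul1r.
have pert0 t p : `|t| <= 1 -> 0 <= excess Omega (fun x => w x + t * w x) p.
  rewrite ler_norml => /andP[t1 _]; apply: excess_ge0 => //.
    by apply: attained_closure => //; apply: within_continuous_perturbation.
  by move=> x Kx; have := w0 Kx; nra.
have fin1 : (dual_energy Omega (fun x => w x + 1 * w x)%R < +oo)%E.
  by rewrite pertE; apply: dual_energy_scale_lty.
have [fE dE] := dual_energy_derivative oOmega bOmega Omega0 cw cw w0 wb pert0 fin1.
split=> //.
(* For [|t| < 1] the function [w + t w] is a positive multiple of [w], so the derivative just found
   is also that of a power of [1 + t]. *)
have dE' : is_derive (0 : R) (1 : R)
    (fun t : R => (1 + t) ^+ n.+2 * fine (dual_energy Omega w))
    (fine (ma_integral Omega w (fun x => - w x))).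
  apply: near_eq_is_derive dE; apply/nbhs_ballP; exists 1 => //= t.
  rewrite -ball_normE /= sub0r normrN ltr_norml => /andP[t1' _].
  have t1 : 0 < 1 + t by lra.
  rewrite pertE dual_energy_scale// fineM// ge0_fin_numE//; exact: dual_energy_ge0.
rewrite /ma_energy -[LHS](@derive_val _ _ _ _ _ _ _ dE').
pose f : R -> R := cst 1 + id.
have d1 : is_derive (0 : R) (1 : R) f (0 + 1) by exact: is_deriveD.
have dX : is_derive (0 : R) (1 : R) (fine (dual_energy Omega w) \*: (f ^+ n.+2))
    (fine (dual_energy Omega w) *: ((n.+2%:R * f 0 ^+ n.+1) *: (0 + 1))).
  exact: is_deriveZ.
rewrite (_ : (fun t : R => _) = fine (dual_energy Omega w) \*: (f ^+ n.+2)).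
  rewrite (@derive_val _ _ _ _ _ _ _ dX) (_ : f 0 = 1); last exact: addr0.
  by rewrite expr1n add0r mulr1 [_ *: 1]mulr1 [_ *: _]mulrC.
by apply/funext => t; rewrite exprfctE /= [RHS]mulrC.
Qed.

End energy_formula.

(** * Continuity of bounded convex functions *)

Section convex_continuity.
Context {R : realType} {n : nat}.
Notation V := 'rV[R]_n.

Lemma within_continuous_ballP (K : set V) (f : V -> R) :
  (forall x e, K x -> 0 < e ->
    exists2 d, 0 < d & forall y, K y -> `|x - y| < d -> `|f x - f y| < e) ->
  {within K, continuous f}.
Proof.
move=> fK; apply/subspace_continuousP => x Kx A /(@nbhs_normP R _ (f x) A).1[e e0 eA].
have [d d0 xd] := fK x e Kx e0.
apply: (@nbhs_normP R _ x _).2; exists d => //= y xy Ky.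
by apply: eA; exact: xd.
Qed.

(* Writing [y = s z + (1 - s) x] bounds [f y - f x] by [s (f z - f x)], and
   reflecting [z] through [x] bounds [f x - f y]. *)
Lemma convex_bounded_continuous (D : set V) (f : V -> R) (M : R) :
  open D -> convex_function D f -> (forall x, D x -> `|f x| <= M) ->
  forall x e, D x -> 0 < e ->
    exists2 d, 0 < d & forall y, `|x - y| < d -> `|f x - f y| < e.
Proof.
move=> oD /convex_functionP cf fM x e Dx e0.
have M0 : 0 <= M by apply: le_trans (fM x Dx).
have := oD; rewrite openE => /(_ _ Dx) /(@nbhs_normP R _ x D).1 [r /= r0 rD].
have Me : 0 < 2 * M + e + 1 by lra.
(* This value is below [1] and satisfies [s * (2 * M) < e], where [2 * M] bounds the oscillation of
   [f]. *)
pose s := e / (2 * M + e + 1).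
have s0 : 0 < s by rewrite divr_gt0.
have s1 : s < 1 by rewrite ltr_pdivrMr//; lra.
have sM : s * (2 * M) < e.
  by rewrite /s mulrAC ltr_pdivrMr// ltr_pM2l//; lra.
exists (s * r) => [|y xy]; first by rewrite mulr_gt0.
have zr : `|s^-1 *: (y - x)| < r.
  by rewrite normrZ gtr0_norm ?invr_gt0// ltr_pdivrMl// distrC.
have Dz1 : D (x + s^-1 *: (y - x)).
  by apply: rD => /=; rewrite opprD addNKr normrN.
have Dz2 : D (x - s^-1 *: (y - x)).
  by apply: rD => /=; rewrite opprB addrC subrK.
have sn0 : s != 0 by rewrite gt_eqF.
have E1 : s *: (x + s^-1 *: (y - x)) + (1 - s) *: x = y.
  by apply/rowP => j; rewrite !mxE; field.
have Dy : D y.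
  rewrite -E1; apply: (rD) => /=; rewrite E1.
  by apply: lt_trans xy _; rewrite gtr_pMl.
have s1' : 0 < 1 + s by lra.
have sn1 : 1 + s != 0 by rewrite gt_eqF.
have E2 : (1 + s)^-1 *: y + (1 - (1 + s)^-1) *: (x - s^-1 *: (y - x)) = x.
  by apply/rowP => j; rewrite !mxE; field; rewrite sn0 sn1.
have s01 : 0 <= s <= 1 by rewrite !ltW.
have t01 : 0 <= (1 + s)^-1 <= 1.
  by rewrite invr_ge0 (ltW s1') invf_le1//; lra.
have := cf _ _ _ s01 Dz1 Dx; have := cf _ _ _ t01 Dy Dz2.
rewrite E1 E2 => h2 h1.
have {h2}h2 : (1 + s) * f x <= f y + s * f (x - s^-1 *: (y - x)).
  rewrite (_ : f y + _ = (1 + s) * ((1 + s)^-1 * f y +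
    (1 - (1 + s)^-1) * f (x - s^-1 *: (y - x)))); first by rewrite ler_pM2l.
  by field.
have := fM _ Dz1; have := fM _ Dz2; have := fM _ Dx.
rewrite !ler_norml => /andP[x1 x2] /andP[_ z2] /andP[_ z1].
have := ler_wpM2l (ltW s0) z1; have := ler_wpM2l (ltW s0) z2.
have := ler_wpM2l (ltW s0) x1.
by rewrite ltr_norml; move=> *; apply/andP; split; lra.
Qed.

End convex_continuity.

(** * Convex envelopes of the perturbations *)

Section envelope.
Context {R : realType} {n : nat} (Omega : set 'rV[R]_n.+1).
Notation V := 'rV[R]_n.+1.
Notation K := (closure Omega).
Hypotheses (oOmega : open Omega) (Omega0 : Omega !=set0)
  (cvxOmega : convex_set Omega) (bOmega : bounded_set Omega).

Section minorant.
Variables f g : V -> R.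
(** The minorant [g] makes the family defining the envelope nonempty, so that its [sup] is a genuine
    supremum on [K]. *)
Hypotheses (gf : forall y, K y -> g y <= f y) (cg : convex_function K g).
Notation Gamma := (convex_envelope Omega f).

Lemma convex_envelope_le x : K x -> Gamma x <= f x.
Proof.
move=> Kx; apply: ge_sup; first by exists (g x), g.
by move=> _ [phi [phif _] <-]; exact: phif.
Qed.

Lemma convex_envelope_ge phi x : K x -> (forall y, K y -> phi y <= f y) ->
  convex_function K phi -> phi x <= Gamma x.
Proof.
move=> Kx phif cphi; apply: ub_le_sup; last by exists phi.
by exists (f x) => _ [psi [psif _] <-]; exact: psif.
Qed.

Lemma convex_envelope_convex : convex_function K Gamma.
Proof.
apply/convex_functionP => t x y t01 Kx Ky.
apply: ge_sup; first by exists (g (t *: x + (1 - t) *: y)), g.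
move=> _ [phi [phif cphi] <-].
have /convex_functionP/(_ _ _ _ t01 Kx Ky) := cphi.
move=> /le_trans; apply; case/andP: t01 => t0 t1.
by apply: lerD; apply: ler_wpM2l; rewrite ?subr_ge0//; exact: convex_envelope_ge.
Qed.

(** The affine function of slope [p] that touches [f] at [x] is a convex minorant of [f], hence lies
    below the envelope. *)
Lemma argmax_convex_envelope p x : argmax K f p x -> argmax K Gamma p x.
Proof.
move=> [Kx px]; split=> // y Ky.
pose phi z := dotrV p z - (dotrV p x - f x).
have phi_le : phi y <= Gamma y.
  apply: convex_envelope_ge => //; first by move=> z /px; rewrite /phi; lra.
  apply/convex_functionP => t a b _ _ _.
  by rewrite /phi dotrVDr !dotrVZr; lra.
by have := convex_envelope_le Kx; move: phi_le; rewrite /phi; lra.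
Qed.

(** A function and its envelope have the same affine minorants, and the transform at [p] records the
    highest one of slope [p]. *)
Lemma legendre_convex_envelope p : attained K f ->
  legendre K Gamma p = legendre K f p.
Proof.
move=> af; have [x px] := af p.
have Gx := legendre_argmax (argmax_convex_envelope px).
apply/eqP; rewrite eq_le; apply/andP; split; last first.
  rewrite Gx (legendre_argmax px).
  by have := convex_envelope_le px.1; lra.
rewrite Gx.
have : dotrV p x - legendre K f p <= Gamma x.
  apply: (@convex_envelope_ge (fun z => dotrV p z - legendre K f p)) => //.
  - exact: px.1.
  - by move=> y Ky; have := le_legendre p af Ky; lra.
  - by apply/convex_functionP => t a b _ _ _; rewrite dotrVDr !dotrVZr; lra.
by lra.
Qed.

Hypotheses (cg' : {within K, continuous g})
  (gb : forall x, boundary Omega x -> g x = 0)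
  (fb : forall x, boundary Omega x -> f x = 0).

(** At the boundary the envelope is squeezed between [g] and [0]; inside, it is convex and bounded,
    hence continuous. *)
Lemma convex_envelope_zero_boundary : convex_zero_boundary Omega Gamma.
Proof.
have Gb x : boundary Omega x -> Gamma x = 0.
  move=> bx; apply/eqP; rewrite eq_le; apply/andP; split.
    by rewrite -[leRHS](fb bx); exact: convex_envelope_le bx.1.
  by rewrite -[leLHS](gb bx); exact: convex_envelope_ge bx.1 _ _.
have G0 x : K x -> Gamma x <= 0.
  apply: (convex_le0 oOmega bOmega convex_envelope_convex).
  by move=> y /Gb ->.
have gG x : K x -> g x <= Gamma x by move=> Kx; exact: convex_envelope_ge.
have cG : convex_function Omega Gamma.
  apply/convex_functionP => t x y t01 Ox Oy.
  have /convex_functionP := convex_envelope_convex.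
  by apply => //; exact: subset_closure.
split=> //; apply: within_continuous_ballP => x e Kx e0.
have [Ox|Ox] := pselect (Omega x); last first.
  have bx : boundary Omega x by split=> // /interior_subset.
  have [d d0 xd] := within_continuous_ball cg' Kx e0.
  exists d => // y Ky /(xd y Ky); rewrite gb// Gb// !sub0r !normrN.
  rewrite !ler0_norm; [|exact: G0|exact: le_trans (gG y Ky) (G0 y Ky)].
  by move=> h; apply: le_lt_trans h; rewrite lerN2 gG.
have cng : {within K, continuous (fun y => `|g y|)}.
  by move=> z; apply: cvg_norm; exact: cg'.
have [c _ cmax] := EVT_max_rV (closure_nonempty Omega0)
  (compact_closure_bounded bOmega) cng.
have GM y : Omega y -> `|Gamma y| <= `|g c|.
  move=> /(@subset_closure _ _) Ky; rewrite ler0_norm ?G0//.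
  apply: le_trans (cmax y (mem_set Ky)).
  by have := gG y Ky; have := ler_norm (- g y); rewrite normrN; lra.
have [d d0 xd] := convex_bounded_continuous oOmega cG GM Ox e0.
by exists d => // y _; exact: xd.
Qed.

End minorant.

Variables u v : V -> R.
Hypotheses (Wu : convex_zero_boundary Omega u) (Wv : convex_zero_boundary Omega v).
Notation perturb t := (fun x => u x + t * v x).

(** For [t >= 0] the perturbation is itself convex; for [t < 0] the term [t * v] is nonnegative and
    [u] is a minorant. *)
Lemma perturb_minorant t : exists g, [/\ forall y, K y -> g y <= perturb t y,
  convex_function K g, {within K, continuous g} &
  forall x, boundary Omega x -> g x = 0].
Proof.
have [cu xu ub] := Wu; have [cv xv vb] := Wv.
have [t0|t0] := leP 0 t.
  exists (perturb t); split=> //.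
  - have /convex_functionP Ku := convex_function_closure cvxOmega cu xu.
    have /convex_functionP Kv := convex_function_closure cvxOmega cv xv.
    apply/convex_functionP => s x y s01 Kx Ky.
    have := Ku _ _ _ s01 Kx Ky; have := ler_wpM2l t0 (Kv _ _ _ s01 Kx Ky).
    by lra.
  - exact: within_continuous_perturbation.
  - by move=> x bx; rewrite ub// vb// mulr0 addr0.
exists u; split=> //; last exact: convex_function_closure.
move=> y Ky; rewrite lerDl.
have := convex_zero_boundary_le0 oOmega cvxOmega bOmega Wv Ky; nra.
Qed.

Lemma envelope_perturb t :
  convex_zero_boundary Omega (convex_envelope Omega (perturb t)).
Proof.
have [g [gf cg cg' gb]] := perturb_minorant t.
have [_ _ ub] := Wu; have [_ _ vb] := Wv.
apply: (convex_envelope_zero_boundary gf cg cg' gb) => x bx.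
by rewrite ub// vb// mulr0 addr0.
Qed.

Lemma excess_envelope_perturb t :
  excess Omega (convex_envelope Omega (perturb t)) = excess Omega (perturb t).
Proof.
have [g [gf cg _ _]] := perturb_minorant t.
have [cu _ _] := Wu; have [cv _ _] := Wv.
apply/funext => p; rewrite /excess (legendre_convex_envelope gf)//.
by apply: attained_closure => //; exact: within_continuous_perturbation.
Qed.

(** For negative [t] the perturbation may be positive somewhere, but its envelope is nonpositive and
    has the same excess. *)
Lemma excess_perturb_ge0 t p : 0 <= excess Omega (perturb t) p.
Proof.
rewrite -excess_envelope_perturb; have WG := envelope_perturb t.
apply: excess_ge0 => //; last exact: convex_zero_boundary_le0.
by apply: attained_closure => //; case: WG.
Qed.

(** By [excess_midpoint] the excess of [u + v] is dominated by those of [2 u] and [2 v], whose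
    integrals are finite by homogeneity. *)
Lemma dual_energy_add_lty :
  (dual_energy Omega u < +oo)%E -> (dual_energy Omega v < +oo)%E ->
  (dual_energy Omega (perturb 1) < +oo)%E.
Proof.
move=> Du Dv; have [cu _ _] := Wu; have [cv _ _] := Wv.
have pert1 : perturb 1 = (fun x => u x + v x).
  by apply/funext => x; rewrite mul1r.
have auv : attained K (fun x => u x + v x).
  rewrite -pert1; apply: attained_closure => //.
  exact: within_continuous_perturbation.
have m2 w : convex_zero_boundary Omega w -> attained K (fun x => 2 * w x).
  by move=> [cw _ _]; apply: attained_scale => //; exact: attained_closure.
have pos w p : convex_zero_boundary Omega w -> 0 <= excess Omega (fun x => 2 * w x) p.
  move=> Ww; apply: excess_ge0 => //; first exact: m2.
  by move=> x /(convex_zero_boundary_le0 oOmega cvxOmega bOmega Ww); lra.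
have meas w : attained K w ->
    measurable_fun setT (fun p : borel_rV R n.+1 => (excess Omega w p)%:E).
  by move=> aw; apply/measurable_EFinP; apply: measurable_excess.
apply: (@le_lt_trans _ _ (dual_energy Omega (fun x => (2 * u x)%R) +
    dual_energy Omega (fun x => (2 * v x)%R))%E); last first.
  by apply: lte_add_pinfty; apply: dual_energy_scale_lty.
rewrite /dual_energy -ge0_integralD//; last 4 first.
- by move=> p _; rewrite lee_fin pos.
- by apply: meas; exact: m2.
- by move=> p _; rewrite lee_fin pos.
- by apply: meas; exact: m2.
apply: ge0_le_integral => //.
- by move=> p _; rewrite lee_fin excess_perturb_ge0.
- by rewrite pert1; exact: meas.
- by apply: emeasurable_funD; apply: meas; exact: m2.
move=> p _; rewrite -EFinD lee_fin pert1.
have := excess_midpoint p auv (attained_closure bOmega Omega0 cu)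
  (attained_closure bOmega Omega0 cv).
by have := pos u p Wu; have := pos v p Wv; lra.
Qed.

End envelope.

(** * Derivative of the energy of the envelopes *)

Theorem theorem1p3 (R : realType) (n : nat) (n_gt0 : (0 < n)%N)
    (Omega : set 'rV[R]_n) (u v : 'rV[R]_n -> R)
    (hOmega : bounded_convex_domain Omega)
    (hu : finite_energy Omega u)
    (hv : finite_energy Omega v)
    (hv_lip : [lipschitz v x | x in closure Omega]) :
  let Gamma (t : R) := convex_envelope Omega (fun x => u x + t * v x) in
  [/\ (\forall t \near (0 : R), ma_energy Omega (Gamma t) \is a fin_num),
      ma_integral Omega u (fun x => - v x) \is a fin_num &
      is_derive (0 : R) (1 : R) (fun t : R => fine (ma_energy Omega (Gamma t)))
        (n.+1%:R * fine (ma_integral Omega u (fun x => - v x)))].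
Proof.
(* The dimension is rewritten as [n.+1], so the factor of the statement becomes [n.+2]. *)
case: n n_gt0 Omega u v hOmega hu hv hv_lip => // n _ Omega u v.
move=> [oO O0 cO bO] [cu xu ub Eu] [cv xv vb Ev] _ Gamma.
have Wu : convex_zero_boundary Omega u by [].
have Wv : convex_zero_boundary Omega v by [].
have v0 := convex_zero_boundary_le0 oO cO bO Wv.
have D1 := dual_energy_add_lty oO O0 cO bO Wu Wv
  (dual_energy_lty oO O0 cO bO Wu Eu) (dual_energy_lty oO O0 cO bO Wv Ev).
have pert0 t p := excess_perturb_ge0 oO O0 cO bO Wu Wv t p.
have [fD dD] := dual_energy_derivative oO bO O0 cu cv v0 vb
  (fun t p _ => pert0 t p) D1.
have near1 : \forall t \near (0 : R), `|t| <= 1.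
  apply/nbhs_ballP; exists 1 => //= t.
  by rewrite -ball_normE /= sub0r normrN => /ltW.
have EG t : `|t| <= 1 -> ma_energy Omega (Gamma t) \is a fin_num /\
    fine (ma_energy Omega (Gamma t)) =
    n.+2%:R * fine (dual_energy Omega (fun x => u x + t * v x)).
  move=> t1; have EE : dual_energy Omega (Gamma t) =
      dual_energy Omega (fun x => u x + t * v x).
    by rewrite /dual_energy (excess_envelope_perturb oO O0 cO bO Wu Wv).
  rewrite -EE; apply: energy_formula => //; first exact: envelope_perturb.
  rewrite EE.
  have := excess_integrable bO O0 cu cv v0 (fun t p _ => pert0 t p) D1 t1.
  by move=> /(integrable_fin_num measurableT); rewrite fin_numElt => /andP[].
split=> //; first by apply: filterS near1 => t /EG[].
(* The energy of [Gamma t] equals [n.+2] times the dual energy for [|t| <= 1], a neighborhood of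
   [0], so the derivatives at [0] agree. *)
have := is_deriveZ n.+2%:R dD.
apply: near_eq_is_derive; apply: filterS near1 => t /EG[_ ->].
by [].
Qed.
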